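(* Let $m\in\{2,4,6\}$, let $M$ be the number of vortices, $h>0$, $\delta>0$ and $\omega_1,\dots,\omega_M\in\mathbb{R}$. Consider the one-step method with time step $\tau$ which, given $(\bm{x}^k,\bm{y}^k)\in\mathbb{R}^M\times\mathbb{R}^M$, defines $(\bm{x}^{k+1},\bm{y}^{k+1})\in\mathbb{R}^M\times\mathbb{R}^M$ implicitly by $$\frac{x_i^{k+1}-x_i^k}{\tau}+\frac{h^2}{2\pi}\sum_{j=1,\,j\ne i}^M\omega_j\,\frac{\overline{y_{ij}}}{(r_{ij}^k)^2}\,C_{ij}^{\tau,(m)}=0,\qquad \frac{y_i^{k+1}-y_i^k}{\tau}-\frac{h^2}{2\pi}\sum_{j=1,\,j\ne i}^M\omega_j\,\frac{\overline{x_{ij}}}{(r_{ij}^k)^2}\,C_{ij}^{\tau,(m)}=0,\qquad 1\le i\le M,$$ as a discretization of the vortex-blob equations of order $m$, $$\dot x_i=-\frac{h^2}{2\pi}\sum_{j=1,\,j\ne i}^M\omega_j\frac{y_{ij}}{r_{ij}^2}\Big(1-Q^{(m)}\big(r_{ij}^2/\delta^2\big)e^{-r_{ij}^2/\delta^2}\Big),\qquad \dot y_i=\frac{h^2}{2\pi}\sum_{j=1,\,j\ne i}^M\omega_j\frac{x_{ij}}{r_{ij}^2}\Big(1-Q^{(m)}\big(r_{ij}^2/\delta^2\big)e^{-r_{ij}^2/\delta^2}\Big),\qquad 1\le i\le M.$$ This method is symmetric, and it is second-order accurate in time.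
   Context: For a configuration $(\bm{x},\bm{y})\in\mathbb{R}^M\times\mathbb{R}^M$ the $i$-th vortex has position $(x_i,y_i)$; put $x_{ij}=x_i-x_j$, $y_{ij}=y_i-y_j$, $r_{ij}=\sqrt{x_{ij}^2+y_{ij}^2}$. The positions of distinct vortices are assumed distinct, so that $r_{ij}>0$ for $i\ne j$. Superscripts $k$, $k+1$ denote evaluation at $(\bm{x}^k,\bm{y}^k)$ and $(\bm{x}^{k+1},\bm{y}^{k+1})$. Write $\overline{x_{ij}}=(x_{ij}^{k+1}+x_{ij}^k)/2$, $\overline{y_{ij}}=(y_{ij}^{k+1}+y_{ij}^k)/2$, $\xi_{ij}^k=(r_{ij}^k/\delta)^2$, $\xi_{ij}^{k+1}=(r_{ij}^{k+1}/\delta)^2$, $\Delta\xi_{ij}=\xi_{ij}^{k+1}-\xi_{ij}^k$. The exponential integral is $E_1(x)=\int_x^\infty\frac{e^{-t}}{t}\,dt$ for $x>0$. Also $Q^{(2)}(r)=1$, $Q^{(4)}(r)=1-r$, $Q^{(6)}(r)=1-2r+\tfrac{r^2}{2}$. Coefficients of the scheme (for $\xi_{ij}^{k+1}\ne\xi_{ij}^k$): $$C_{ij}^{\tau,(2)}=\frac{1}{\frac{\xi_{ij}^{k+1}}{\xi_{ij}^k}-1}\Big[\log\Big|\frac{\xi_{ij}^{k+1}}{\xi_{ij}^k}\Big|+E_1(\xi_{ij}^{k+1})-E_1(\xi_{ij}^k)\Big],$$ $$C_{ij}^{\tau,(4)}=\frac{1}{\frac{\xi_{ij}^{k+1}}{\xi_{ij}^k}-1}\Big[\log\Big|\frac{\xi_{ij}^{k+1}}{\xi_{ij}^k}\Big|+E_1(\xi_{ij}^{k+1})-E_1(\xi_{ij}^k)-e^{-\xi_{ij}^k}\big(e^{-\Delta\xi_{ij}}-1\big)\Big],$$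 $$C_{ij}^{\tau,(6)}=\frac{1}{\frac{\xi_{ij}^{k+1}}{\xi_{ij}^k}-1}\Big[\log\Big|\frac{\xi_{ij}^{k+1}}{\xi_{ij}^k}\Big|+E_1(\xi_{ij}^{k+1})-E_1(\xi_{ij}^k)+e^{-\xi_{ij}^k}\big(e^{-\Delta\xi_{ij}}-1\big)\big(-\tfrac32+\tfrac12\xi_{ij}^k\big)\Big]+\tfrac12\,\xi_{ij}^k\,e^{-\xi_{ij}^{k+1}}.$$ When $\xi_{ij}^{k+1}=\xi_{ij}^k$, $C_{ij}^{\tau,(m)}$ is understood as its limiting value $1-Q^{(m)}(\xi_{ij}^k)e^{-\xi_{ij}^k}$. Symmetric: if $\Phi^\tau$ is the discrete flow of a one-step method with time step $\tau$, its adjoint is $(\Phi^\tau)^*=(\Phi^{-\tau})^{-1}$, and the method is symmetric if $(\Phi^\tau)^*=\Phi^\tau$; for the implicit scheme above this means that the defining equations are unchanged when $(\bm{x}^k,\bm{y}^k)$ and $(\bm{x}^{k+1},\bm{y}^{k+1})$ are exchanged and $\tau$ is replaced by $-\tau$. Second-order accurate in time: the error at a fixed final time between the numerical solution and the exact solution of the vortex-blob equations is $O(\tau^2)$ as $\tau\to0$. *)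

(* Defs.v *)
From HB Require Import structures.
From mathcomp Require Import all_boot all_order all_algebra.
From mathcomp Require Import all_classical all_reals all_analysis.
Set Implicit Arguments.
Unset Strict Implicit.
Unset Printing Implicit Defensive.
Import Order.TTheory GRing.Theory Num.Theory.
Import numFieldNormedType.Exports.
Local Open Scope classical_set_scope.
Local Open Scope ring_scope.

(* A pair (x, y) of coordinate vectors; vortex i sits at (x 0 i, y 0 i).
   The norm on this type is the sup norm over all 2M coordinates. *)
Notation config R M := ('rV[R]_M * 'rV[R]_M)%type.

Section Methods.
Context {R : realType} {V : normedModType R}.

(* A possibly implicit one-step method is given by the graph of its discrete
   flow: [Phi tau z z'] means that z' is obtained from z by one step of
   size tau.  The graph of an inverse is the converse relation. *)
Definition one_step_method := R -> V -> V -> Prop.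

(* The graph of (Phi^{-tau})^{-1}. *)
Definition adjoint (Phi : one_step_method) : one_step_method :=
  fun tau z z' => Phi (- tau) z' z.

Definition symmetric_method (Phi : one_step_method) : Prop :=
  forall tau z z', adjoint Phi tau z z' <-> Phi tau z z'.

Definition numerical_solution (Phi : one_step_method) (tau : R) (N : nat)
    (z0 : V) (u : nat -> V) : Prop :=
  u 0%N = z0 /\ forall k, (k < N)%N -> Phi tau (u k) (u k.+1).

(* [sol T z] means that z is an exact solution on [0, T].  For all
   sufficiently small steps tau = T / N the implicit equations can be solved up
   to the final time T, and every numerical solution started at the exact
   initial value has error at most K tau^p at T.  K and tau0 depend on T and on
   the exact solution, but not on tau. *)
Definition accurate_of_order (p : nat) (Phi : one_step_method)
    (sol : R -> (R -> V) -> Prop) : Prop :=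
  forall (T : R) (z : R -> V), 0 < T -> sol T z ->
  exists K tau0 : R, 0 < tau0 /\
    forall (tau : R) (N : nat), 0 < tau <= tau0 -> N%:R * tau = T ->
      (exists u, numerical_solution Phi tau N (z 0) u) /\
      (forall u, numerical_solution Phi tau N (z 0) u ->
         `|u N - z T| <= K * tau ^+ p).

End Methods.

Section VortexBlob.
Context {R : realType}.

Definition E1 (x : R) : R :=
  \int[lebesgue_measure]_(t in `[x, +oo[) (expR (- t) / t).

(* Only used for m = 2, 4, 6. *)
Definition Q (m : nat) (r : R) : R :=
  match m with
  | 2%N => 1
  | 4%N => 1 - r
  | 6%N => 1 - 2 * r + r ^+ 2 / 2
  | _ => 0
  end.

(* The coefficient C^{tau,(m)} as a function of a = xi^k and b = xi^{k+1}.
   Only used for m = 2, 4, 6. *)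
Definition blob_coef (m : nat) (a b : R) : R :=
  if b == a then 1 - Q m a * expR (- a)
  else
    let L := ln `|b / a| + E1 b - E1 a in
    let D := expR (- a) * (expR (- (b - a)) - 1) in
    match m with
    | 2%N => (b / a - 1)^-1 * L
    | 4%N => (b / a - 1)^-1 * (L - D)
    | 6%N => (b / a - 1)^-1 * (L + D * (- (3 / 2) + 1 / 2 * a))
             + 1 / 2 * a * expR (- b)
    | _ => 0
    end.

Context {M : nat}.
Implicit Types z : config R M.

Definition dx z (i j : 'I_M) : R := z.1 0 i - z.1 0 j.
Definition dy z (i j : 'I_M) : R := z.2 0 i - z.2 0 j.
Definition dist z (i j : 'I_M) : R :=
  Num.sqrt (dx z i j ^+ 2 + dy z i j ^+ 2).

Definition distinct_positions z : Prop :=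
  forall i j, i != j -> 0 < dist z i j.

Definition xi (delta : R) z i j : R := (dist z i j / delta) ^+ 2.

Section Equations.
Variables (m : nat) (h delta : R) (omega : 'I_M -> R).

Definition velocity_x z (i : 'I_M) : R :=
  - (h ^+ 2 / (2 * pi)) * \sum_(j < M | j != i) omega j *
    (dy z i j / dist z i j ^+ 2) *
    (1 - Q m (dist z i j ^+ 2 / delta ^+ 2) *
         expR (- (dist z i j ^+ 2 / delta ^+ 2))).

Definition velocity_y z (i : 'I_M) : R :=
  h ^+ 2 / (2 * pi) * \sum_(j < M | j != i) omega j *
    (dx z i j / dist z i j ^+ 2) *
    (1 - Q m (dist z i j ^+ 2 / delta ^+ 2) *
         expR (- (dist z i j ^+ 2 / delta ^+ 2))).

(* At the endpoints 0 and T only one-sided continuity is required; the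
   one-sided derivatives there are then automatic. *)
Definition blob_solution (T : R) (z : R -> config R M) : Prop :=
  [/\ {within `[0, T], continuous z},
      (forall t : R, 0 <= t <= T -> distinct_positions (z t)) &
      forall t : R, 0 < t < T -> forall i,
        is_derive t 1 (fun s => (z s).1 0 i) (velocity_x (z t) i) /\
        is_derive t 1 (fun s => (z s).2 0 i) (velocity_y (z t) i)].

Definition mean_dx (z z' : config R M) i j : R := (dx z' i j + dx z i j) / 2.
Definition mean_dy (z z' : config R M) i j : R := (dy z' i j + dy z i j) / 2.

Definition blob_scheme : @one_step_method R (config R M) := fun tau z z' =>
  [/\ tau != 0, distinct_positions z, distinct_positions z' &
  forall i : 'I_M,
    (z'.1 0 i - z.1 0 i) / tau + h ^+ 2 / (2 * pi) *
      (\sum_(j < M | j != i) omega j *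
         (mean_dy z z' i j / dist z i j ^+ 2) *
         blob_coef m (xi delta z i j) (xi delta z' i j)) = 0 /\
    (z'.2 0 i - z.2 0 i) / tau - h ^+ 2 / (2 * pi) *
      (\sum_(j < M | j != i) omega j *
         (mean_dx z z' i j / dist z i j ^+ 2) *
         blob_coef m (xi delta z i j) (xi delta z' i j)) = 0].

End Equations.
End VortexBlob.

(* Main.v *)
Require Import Defs.
From HB Require Import structures.
From mathcomp Require Import all_boot all_order all_algebra.
From mathcomp Require Import all_classical all_reals all_analysis.
From mathcomp Require Import measurable_realfun ring lra.
Set Implicit Arguments.
Unset Strict Implicit.
Unset Printing Implicit Defensive.
Import Order.TTheory GRing.Theory Num.Theory.
Import numFieldNormedType.Exports.
Local Open Scope classical_set_scope.
Local Open Scope ring_scope.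

(* Put psi(t) = (1 - Q(t) e^{-t}) / t.  Since
     G(t) = ln t + E1(t) + q(t) e^{-t},   q = 0, -1, t/2 - 3/2 for m = 2, 4, 6,
   is a primitive of psi on t > 0, the quantity C / xi^k is the divided
   difference (G(xi^{k+1}) - G(xi^k)) / (xi^{k+1} - xi^k).  It is symmetric in
   its two arguments, hence so is the scheme.  It equals the mean of psi over
   the segment [xi^k, xi^{k+1}], so it is globally bounded (psi is) and locally
   Lipschitz, and it agrees with the trapezoidal mean of psi to second order.
   The scheme is thus an implicit rule z' = z + tau F(z, z') that agrees with
   the trapezoidal rule up to O(tau^3) along the exact solution.  The bound on F
   confines every solution of the implicit equation to a small neighbourhood of
   z, where F is Lipschitz: a contraction argument gives existence of the next
   step, and a discrete Gronwall estimate gives the global O(tau^2) error. *)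

(** * Implicit one-step methods *)

(** Banach's theorem on the closed ball [U] of radius [r]. The first inequality makes the ball
    stable, the second gives contraction constant 1/2, and closedness of the ball keeps the limit in
    it. *)
Lemma contraction_fixed_point (R : realType) (X : completeNormedModType R)
    (f : X -> X) (u : X) (r : R) : 0 < r ->
  (forall v, `|v - u| <= r -> `|f v - u| <= r) ->
  (forall v w, `|v - u| <= r -> `|w - u| <= r ->
     `|f v - f w| <= 2^-1 * `|v - w|) ->
  exists2 p, `|p - u| <= r & p = f p.
Proof.
move=> r0 fU fc; pose U := [set v : X | `|v - u| <= r].
have fun_f : {homo f : x / U x} by move=> v /fU.
pose F : {fun U >-> U} := HB.pack f (isFun.Build _ _ _ _ f fun_f).
have := @banach_fixed_point R X U F; apply.
- exists (2^-1)%:nng; split; first by rewrite /=; lra.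
  by move=> [v w] [/= Uv Uw]; exact: fc.
- have -> : U = closed_ball_ (fun v : X => `|v|) u r.
    by apply/seteqP; split => v /=; rewrite /closed_ball_ /U /= distrC.
  exact: closed_closed_ball_.
- by exists u; rewrite /U /= subrr normr0 ltW.
Qed.

(* The library lacks the pointed-uniform instances of products. *)
HB.saturate prod.

(** Balls of the product are products of balls, so both projections of a Cauchy filter are Cauchy
    and their limits pair up. Completeness of the configuration space is needed for the fixed-point
    argument. *)
Lemma prod_complete (R : realType) (U V : completeNormedModType R)
    (F : set_system (U * V)) :
  ProperFilter F -> cauchy F -> cvg F.
Proof.
move=> FF /cauchyP Fc.
have /cauchy_cvg/cvg_ex[a Fa] : cauchy (fst @ F).
  apply/cauchyP => e e0; have [p Fp] := Fc e e0.
  by exists p.1; have : F (fst @^-1` ball p.1 e) by apply: filterS Fp => q [].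
have /cauchy_cvg/cvg_ex[b Fb] : cauchy (snd @ F).
  apply/cauchyP => e e0; have [p Fp] := Fc e e0.
  by exists p.2; have : F (snd @^-1` ball p.2 e) by apply: filterS Fp => q [].
apply/cvg_ex; exists (a, b).
apply/cvg_ballP => e e0.
move/cvg_ballP: Fa => /(_ e e0) Fa; move/cvg_ballP: Fb => /(_ e e0) Fb.
exact: filterI Fa Fb.
Qed.

HB.instance Definition _ (R : realType) (U V : completeNormedModType R) :=
  Uniform_isComplete.Build (U * V)%type (@prod_complete R U V).
HB.instance Definition _ (R : realType) (m n : nat) :=
  Complete.copy 'M[R]_(m, n) 'M[R]_(m, n).

(** For an implicit step the new error also stands on the right. It is absorbed by dividing by
    [1 - x]: for [x <= 1/2], [(1 + x) / (1 - x) <= 1 + 4 x] and [1 / (1 - x) <= 2]. The gaps in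
    these bounds are the products [ex] (twice) and [kx]. *)
Lemma discrete_gronwall_step (R : realFieldType) (x e e' k : R) :
  0 <= x <= 2^-1 -> 0 <= e -> e' <= e + x * (e + e') + k -> 0 <= k ->
  e' <= (1 + 4 * x) * e + 2 * k.
Proof.
move=> /andP[x0 x1] e0 h k0.
have ex : 0 <= e * (x * (1 - 2 * x)) by rewrite !mulr_ge0//; lra.
have kx : 0 <= k * (1 - 2 * x) by rewrite mulr_ge0//; lra.
have h1 : (1 - x) * e' <= (1 - x) * ((1 + 4 * x) * e + 2 * k) by lra.
by rewrite ler_pM2l in h1 => //; lra.
Qed.

(** * Second-order convergence of an implicit rule along an exact solution *)

Section convergence.
Context {R : realType} {V : completeNormedModType R}.
Context (Phi : @one_step_method R V) (F : V -> V -> V) (S D : set V).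
Context (z : R -> V) (T rho Z B L K : R).
Hypothesis T_gt0 : 0 < T.
Hypothesis rho_gt0 : 0 < rho.
Hypothesis B_gt0 : 0 < B.
Hypothesis L_gt0 : 0 < L.
Hypothesis K_ge0 : 0 <= K.
Hypothesis DS : D `<=` S.
Hypothesis PhiE : forall (tau : R) v v', 0 < tau ->
  Phi tau v v' <-> [/\ S v, S v' & v' = v + tau *: F v v'].
Hypothesis tubeD : forall (t : R) v, 0 <= t <= T -> `|v - z t| <= rho -> D v.
Hypothesis z_bounded : forall t : R, 0 <= t <= T -> `|z t| <= Z.
(** Growth is asked on all of [S], whereas the Lipschitz bound is asked on [D] only: a solution [v']
    of the implicit equation is not known beforehand to lie near the trajectory, and growth is what
    brings it there. *)
Hypothesis F_growth : forall v v', S v -> S v' ->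
  `|F v v'| <= B * (`|v| + `|v'|).
Hypothesis F_lipschitz : forall v v' w w', D v -> D v' -> D w -> D w' ->
  `|F v v' - F w w'| <= L * (`|v - w| + `|v' - w'|).
Hypothesis F_consistent : forall t tau : R, 0 <= t -> 0 < tau -> t + tau <= T ->
  `|z (t + tau) - z t - tau *: F (z t) (z (t + tau))| <= K * tau ^+ 3.

#[local] Arguments DS {_} _.
#[local] Arguments PhiE {tau} _ _ _.
#[local] Arguments tubeD {t v} _ _.
#[local] Arguments z_bounded {t} _.
#[local] Arguments F_growth {v v'} _ _.
#[local] Arguments F_lipschitz {v v' w w'} _ _ _ _.
#[local] Arguments F_consistent {t tau} _ _ _.

Let W := Z + rho.
(** The exponential bounds the product of the [N] factors [1 + 4 tau L], and [2 K T tau^2] is the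
    sum of [N = T / tau] local contributions [2 K tau^3]. *)
Let C := expR (4 * L * T) * (2 * K * T).
(** Sum of all the quantities whose product with [tau] must be small, so that the single condition
    [tau <= tau0] implies every bound of [tau_small]. *)
Let X := L + B + (6 * B * W + K) + C + 1.
Let tau0 := Num.min 2^-1 (rho / 2) / X.

Let Z_ge0 : 0 <= Z.
Proof. by apply: le_trans (@z_bounded 0 _) => //; rewrite lexx ltW. Qed.

Let W_ge0 : 0 <= W. Proof. by rewrite addr_ge0// ltW. Qed.

Let C_ge0 : 0 <= C.
Proof. by rewrite !mulr_ge0 ?expR_ge0// ltW. Qed.

Let BW_ge0 : 0 <= B * W. Proof. by rewrite mulr_ge0// ltW. Qed.

Let X_ge1 : 1 <= X.
Proof. by rewrite /X -mulrA; move: BW_ge0 B_gt0 L_gt0 K_ge0 C_ge0; lra. Qed.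

Let tau0_gt0 : 0 < tau0.
Proof.
rewrite divr_gt0 ?(lt_le_trans _ X_ge1)// lt_min divr_gt0// andbT.
by rewrite invr_gt0.
Qed.

Let tau_small (tau : R) : 0 < tau <= tau0 ->
  [/\ tau <= 1, tau * L <= 2^-1, tau * B <= 2^-1,
      tau * (6 * B * W + K) <= rho / 2 & tau * C <= rho / 2].
Proof.
move=> /andP[t0]; rewrite ler_pdivlMr ?(lt_le_trans _ X_ge1)// le_min.
move=> /andP[h1 h2].
have le_X Y : 0 <= Y -> Y <= X -> tau * Y <= 2^-1 /\ tau * Y <= rho / 2.
  by move=> Y0 YX; split; [apply: le_trans h1|apply: le_trans h2];
    rewrite ler_pM2l.
move: (BW_ge0) (B_gt0) (L_gt0) (K_ge0) (C_ge0) => b1 b2 b3 b4 b5.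
have [h _] : tau * 1 <= 2^-1 /\ tau * 1 <= rho / 2.
  by apply: le_X => //; rewrite X_ge1.
have [hL _] : tau * L <= 2^-1 /\ tau * L <= rho / 2.
  by apply: le_X; rewrite /X -?mulrA; lra.
have [hB _] : tau * B <= 2^-1 /\ tau * B <= rho / 2.
  by apply: le_X; rewrite /X -?mulrA; lra.
have [_ hC] : tau * C <= 2^-1 /\ tau * C <= rho / 2.
  by apply: le_X; rewrite /X -?mulrA; lra.
have [_ hK] : tau * (6 * B * W + K) <= 2^-1 /\
              tau * (6 * B * W + K) <= rho / 2.
  by apply: le_X; rewrite /X -?mulrA; lra.
by split=> //; lra.
Qed.

Let D_z (t : R) : 0 <= t <= T -> D (z t).
Proof. by move=> ht; apply: (tubeD ht); rewrite subrr normr0 ltW. Qed.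

Let tube_bounded (t : R) v : 0 <= t <= T -> `|v - z t| <= rho -> `|v| <= W.
Proof.
move=> ht hv; rewrite -(subrK (z t) v) (le_trans (ler_normD _ _))//.
by rewrite /W addrC lerD// z_bounded.
Qed.

Let z_step (t tau : R) : 0 <= t -> 0 < tau <= tau0 -> t + tau <= T ->
  `|z (t + tau) - z t| <= tau * (2 * B * W + K).
Proof.
move=> t0 /[dup] htau /andP[tau_gt0 _] tT.
have ht : 0 <= t <= T by rewrite t0/= (le_trans _ tT)// lerDl ltW.
have ht' : 0 <= t + tau <= T by rewrite tT andbT addr_ge0// ltW.
have [tau1 _ _ _ _] := tau_small htau.
rewrite -(subrK (tau *: F (z t) (z (t + tau))) (z (t + tau) - z t)).
rewrite (le_trans (ler_normD _ _))//.
have h1 := F_consistent t0 tau_gt0 tT.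
have h2 : `|tau *: F (z t) (z (t + tau))| <= tau * (2 * B * W).
  rewrite normrZ gtr0_norm// ler_pM2l//.
  apply: le_trans (F_growth (DS (D_z ht)) (DS (D_z ht'))) _.
  have := z_bounded ht; have := z_bounded ht' => a1 a2.
  have a3 : `|z t| + `|z (t + tau)| <= 2 * W by rewrite /W; move: rho_gt0; lra.
  by rewrite (mulrC 2) -mulrA ler_pM2l.
rewrite mulrDr addrC; apply: lerD => //; apply: le_trans h1 _.
rewrite (mulrC tau) ler_wpM2l// exprS ler_piMr ?exprn_ile1 ?(ltW tau_gt0)//.
Qed.

(** Two stages: growth alone first places [v'] in the tube around the trajectory, then the Lipschitz
    bound and the consistency defect feed [discrete_gronwall_step]. *)
Let error_step (t tau : R) v v' : 0 <= t -> 0 < tau <= tau0 -> t + tau <= T ->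
  `|v - z t| <= rho / 2 -> Phi tau v v' ->
  `|v' - z (t + tau)| <=
    (1 + 4 * (tau * L)) * `|v - z t| + 2 * (K * tau ^+ 3).
Proof.
move=> t0 /[dup] htau /andP[tau_gt0 _] tT hv.
have ht : 0 <= t <= T by rewrite t0/= (le_trans _ tT)// lerDl ltW.
have ht' : 0 <= t + tau <= T by rewrite tT andbT addr_ge0// ltW.
have [tau1 tauL tauB tauW _] := tau_small htau.
have vrho : `|v - z t| <= rho by move: hv rho_gt0; lra.
move=> /(PhiE _ _ tau_gt0)[Sv Sv' v'E].
have vW := tube_bounded ht vrho.
have step : `|v' - v| <= tau * B * (`|v| + `|v'|).
  rewrite {1}v'E addrC addKr normrZ gtr0_norm// -mulrA ler_pM2l//.
  exact: F_growth.
(* A priori bound: since [tau B <= 1/2], the new state satisfies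
   [|v'| <= |v| + (|v| + |v'|) / 2]. *)
have v'3 : `|v'| <= 3 * `|v|.
  have := ler_normD (v' - v) v; rewrite subrK => h.
  have : tau * B * (`|v| + `|v'|) <= 2^-1 * (`|v| + `|v'|).
    by rewrite ler_wpM2r// addr_ge0.
  by move: step h; lra.
have step' : `|v' - v| <= tau * (4 * B * W).
  apply: le_trans step _; rewrite -!mulrA ler_pM2l// mulrCA ler_pM2l//.
  by move: vW v'3; lra.
have zs := z_step t0 htau tT.
(* One half of [rho] is the distance at time [t]; the other half covers the numerical move
   [tau (4 B W)] and the exact move [tau (2 B W + K)], whence the constant [6 B W + K] in [X]. *)
have v'rho : `|v' - z (t + tau)| <= rho.
  have -> : v' - z (t + tau) = (v' - v) + (v - z t) + (z t - z (t + tau)).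
    by rewrite !addrA !subrK.
  rewrite (le_trans (ler_normD _ _))// (distrC (z t)).
  have := ler_normD (v' - v) (v - z t) => h.
  have -> : rho = rho / 2 + rho / 2 by field.
  apply: le_trans (lerD (le_trans h (lerD step' hv)) zs) _.
  by move: tauW; nra.
have Dv := tubeD ht vrho; have Dv' := tubeD ht' v'rho.
apply: discrete_gronwall_step => //.
- by rewrite mulr_ge0 ?(ltW L_gt0) ?(ltW tau_gt0).
- rewrite [in leLHS](_ : v' - z (t + tau) = (v - z t) +
      tau *: (F v v' - F (z t) (z (t + tau))) -
      (z (t + tau) - z t - tau *: F (z t) (z (t + tau)))); last first.
    rewrite {1}v'E scalerBr; set a := tau *: _; set b := tau *: _.
    rewrite !opprD !opprK !addrA [RHS](ACl (1*3*5*2*6*4*7))/=.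
    by rewrite subrK subrK.
  rewrite (le_trans (ler_normB _ _))// lerD ?F_consistent//.
  rewrite (le_trans (ler_normD _ _))// lerD2l normrZ gtr0_norm// -mulrA.
  by rewrite ler_pM2l//; apply: F_lipschitz => //; exact: D_z.
- by rewrite mulr_ge0// exprn_ge0// ltW.
Qed.

(** The next state is a fixed point of [w |-> v + tau F(v, w)] on the ball of radius [rho / 2]
    around [v]. That ball lies in the tube because [v] is within [rho / 2] of the trajectory. *)
Let solvable_step (t tau : R) v : 0 <= t <= T -> 0 < tau <= tau0 ->
  `|v - z t| <= rho / 2 -> exists v', Phi tau v v'.
Proof.
move=> ht /[dup] htau /andP[tau_gt0 _] hv.
have [tau1 tauL tauB tauW _] := tau_small htau.
have in_tube w : `|w - v| <= rho / 2 -> `|w - z t| <= rho.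
  move=> hw; rewrite -(subrK v w) -addrA (le_trans (ler_normD _ _))//.
  by rewrite (splitr rho) lerD.
have Dball w : `|w - v| <= rho / 2 -> D w by move=> /in_tube; exact: tubeD.
have vv : `|v - v| <= rho / 2 by rewrite subrr normr0 divr_ge0// ltW.
have [||w w'|p pv pE] :=
    @contraction_fixed_point R V (fun w => v + tau *: F v w) v (rho / 2).
- by rewrite divr_gt0.
- move=> w hw; rewrite addrC addKr normrZ gtr0_norm//.
  apply: le_trans tauW; rewrite ler_pM2l//.
  apply: le_trans (F_growth (DS (Dball _ vv)) (DS (Dball _ hw))) _.
  have h1 := tube_bounded ht (in_tube _ vv).
  have h2 := tube_bounded ht (in_tube _ hw).
  have h3 : B * (`|v| + `|w|) <= B * (2 * W) by rewrite ler_pM2l//; lra.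
  by apply: le_trans h3 _; move: BW_ge0 K_ge0; lra.
- move=> hw hw'; rewrite [v + _]addrC addrKA -scalerBr normrZ gtr0_norm//.
  have := F_lipschitz (Dball _ vv) (Dball _ hw) (Dball _ vv) (Dball _ hw').
  rewrite subrr normr0 add0r -(ler_pM2l tau_gt0) mulrA => /le_trans; apply.
  by rewrite ler_wpM2r.
- exists p; apply/(PhiE _ _ tau_gt0); split=> //; apply: DS; exact: Dball.
Qed.

Lemma implicit_one_step_convergence : exists C tau0 : R, 0 < tau0 /\
  forall (tau : R) (N : nat), 0 < tau <= tau0 -> N%:R * tau = T ->
    (exists u, numerical_solution Phi tau N (z 0) u) /\
    (forall u, numerical_solution Phi tau N (z 0) u ->
       `|u N - z T| <= C * tau ^+ 2).
Proof.
exists C, tau0; split=> // tau N /[dup] htau /andP[tau_gt0 _] NT.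
have [tau1 tauL tauB tauW tauC] := tau_small htau.
have kT k : (k <= N)%N -> k%:R * tau <= T.
  by move=> kN; rewrite -NT ler_pM2r// ler_nat.
have k0 k : 0 <= k%:R * tau by rewrite mulr_ge0// ltW.
(* Error envelope at time [k tau]: the final constant [C] with [T] replaced by the elapsed time. It
   dominates the recursion of [error_step] ([E_succ]) and stays below [rho / 2] ([E_rho]), so the
   induction never leaves the tube. *)
pose E k := expR (4 * L * (k%:R * tau)) * (2 * K * (k%:R * tau)) * tau ^+ 2.
have tau2 : 0 <= tau ^+ 2 by rewrite exprn_ge0// ltW.
have E_C k : (k <= N)%N -> E k <= C * tau ^+ 2.
  move=> kN; rewrite ler_wpM2r//; apply: ler_pM.
  - exact: expR_ge0.
  - by apply: mulr_ge0; [rewrite mulr_ge0|exact: k0].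
  - by rewrite ler_expR ler_pM2l ?kT// mulr_gt0.
  - by rewrite ler_wpM2l ?mulr_ge0 ?kT.
have E_rho k : (k <= N)%N -> E k <= rho / 2.
  move=> kN; apply: le_trans (E_C _ kN) _; apply: le_trans tauC.
  by rewrite mulrC ler_wpM2r// expr2 ler_piMl// ltW.
have E_succ k : (1 + 4 * (tau * L)) * E k + 2 * (K * tau ^+ 3) <= E k.+1.
  have e1 : 1 + 4 * (tau * L) <= expR (4 * (tau * L)).
    by rewrite expR_ge1Dx.
  have eS : expR (4 * L * (k.+1%:R * tau)) =
      expR (4 * (tau * L)) * expR (4 * L * (k%:R * tau)).
    by rewrite -expRD; congr expR; rewrite -natr1; ring.
  have e2 : 1 <= expR (4 * L * (k.+1%:R * tau)).
    by rewrite -expR0 ler_expR mulr_ge0// mulr_ge0// ltW.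
  have E0 : 0 <= E k.
    apply: mulr_ge0 => //; apply: mulr_ge0; first exact: expR_ge0.
    by apply: mulr_ge0; [rewrite mulr_ge0|exact: k0].
  have -> : E k.+1 = expR (4 * (tau * L)) * E k +
      expR (4 * L * (k.+1%:R * tau)) * (2 * (K * tau ^+ 3)).
    by rewrite /E eS -natr1; ring.
  apply: lerD; first by rewrite ler_wpM2r.
  by rewrite ler_peMl// mulr_ge0// mulr_ge0// exprn_ge0// ltW.
have bound k u : (k <= N)%N -> numerical_solution Phi tau k (z 0) u ->
    `|u k - z (k%:R * tau)| <= E k.
  elim: k => [|k IH] kN [u0 hu].
    by rewrite u0 mul0r subrr normr0 /E mul0r !mulr0 mul0r.
  have {}IH : `|u k - z (k%:R * tau)| <= E k.
    apply: IH; first exact: ltnW.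
    by split=> // j jk; apply: hu; exact: ltnW.
  have kS : k.+1%:R * tau = k%:R * tau + tau by rewrite -natr1; ring.
  have kST := kT _ kN.
  have small := le_trans IH (E_rho _ (ltnW kN)).
  rewrite kS in kST *.
  have := error_step (k0 k) htau kST small (hu k (ltnSn k)).
  move=> /le_trans; apply; apply: le_trans (E_succ k).
  by rewrite lerD2r ler_wpM2l// addr_ge0// !mulr_ge0// ltW.
split; last first.
  move=> u hu; rewrite -NT; apply: le_trans (bound N u _ hu) _ => //.
  exact: E_C.
(* Existence is obtained by extending a solution one step at a time; the error bound already proved
   for every numerical solution makes the next step solvable. *)
suff : forall k, (k <= N)%N -> exists u, numerical_solution Phi tau k (z 0) u.
  by apply.
elim=> [|k IH] kN; first by exists (fun=> z 0).
have [u [u0 hu]] := IH (ltnW kN).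
have small := le_trans (bound k u (ltnW kN) (conj u0 hu)) (E_rho _ (ltnW kN)).
have ht : 0 <= k%:R * tau <= T by rewrite k0 kT// ltnW.
have [v' hv'] := solvable_step ht htau small.
exists (fun j => if (j <= k)%N then u j else v'); split=> //= j jk.
rewrite -ltnS jk; move: jk; rewrite ltnS leq_eqVlt => /predU1P[->|jk].
  by rewrite ltnn.
by rewrite jk; exact: hu.
Qed.

End convergence.

(** * Lipschitz classes and the trapezoidal rule *)

Section lipschitz_classes.
Context {R : realType}.
Implicit Types (a b c t : R) (f g w phi : R -> R).

Definition lip_on a b f := exists2 L : R, 0 <= L &
  forall s t, a <= s <= b -> a <= t <= b -> `|f s - f t| <= L * `|s - t|.

(* The derivative is only required in the interior, but it must have a
   Lipschitz extension to the closed interval. *)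
Definition C1lip_on a b f := lip_on a b f /\
  exists2 f' : R -> R, lip_on a b f' &
    forall t, a < t < b -> is_derive t 1 f (f' t).

(** Transfers continuity from the trajectory to scalar functions of it, such as norms, coordinates
    and [xi]. No sign is assumed for [C], so the modulus uses [|C| + 1]. *)
Lemma continuous_within_le (V : normedModType R) (a b C : R)
    (z : R -> V) (f : R -> R) : {within `[a, b], continuous z} ->
  (forall s t, a <= s <= b -> a <= t <= b ->
     `|f s - f t| <= C * `|z s - z t|) ->
  {within `[a, b], continuous f}.
Proof.
move=> /subspace_continuousP zc fz; apply/subspace_continuousP => x xab.
have C1 : 0 < `|C| + 1 by rewrite ltr_wpDl.
apply/cvgrPdist_le => e e0.
have /cvgrPdist_le/(_ (e / (`|C| + 1)) (divr_gt0 e0 C1)) := zc x xab.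
rewrite !near_withinE; apply: filterS => t zt tab.
move: xab tab (zt tab); rewrite /= !in_itv/= => xab tab {}zt.
apply: le_trans (fz _ _ xab tab) _.
move: zt; rewrite ler_pdivlMr// mulrC; apply: le_trans.
by rewrite ler_wpM2r// (le_trans (ler_norm _))// lerDl.
Qed.

Lemma lip_on_bounded a b f : lip_on a b f ->
  exists2 C : R, 0 <= C & forall t, a <= t <= b -> `|f t| <= C.
Proof.
move=> [L L0 fL]; exists (`|f a| + L * `|b - a|) => [|t tab].
  by rewrite addr_ge0// mulr_ge0.
have /andP[at_ tb] := tab.
have aab : a <= a <= b by rewrite lexx (le_trans at_ tb).
have := fL _ _ tab aab => h.
rewrite -(subrK (f a) (f t)) (le_trans (ler_normD _ _))// addrC lerD2l.
apply: le_trans h _; rewrite ler_wpM2l// !ger0_norm ?subr_ge0//; last first.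
  exact: le_trans at_ tb.
by rewrite lerD2r.
Qed.

Lemma lip_on_continuous a b f :
  lip_on a b f -> {within `[a, b], continuous f}.
Proof.
move=> [L L0 fL]; apply/subspace_continuousP => x /=; rewrite in_itv/= => xab.
have L1 : 0 < L + 1 by rewrite ltr_wpDl.
apply/cvgrPdist_le => e e0; rewrite near_withinE; near=> t.
rewrite /= in_itv/= => tab.
apply: le_trans (fL _ _ xab tab) _.
have : `|x - t| <= e / (L + 1).
  near: t; apply/nbhs_ballP; exists (e / (L + 1)); first exact: divr_gt0.
  by move=> t /=; rewrite -ball_normE /= => /ltW.
rewrite ler_pdivlMr// mulrC; apply: le_trans.
by rewrite ler_wpM2r// lerDl.
Unshelve. all: by end_near. Qed.

Lemma lip_on_cst a b c : lip_on a b (fun=> c).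
Proof. by exists 0 => // s t _ _; rewrite subrr normr0 mul0r. Qed.

Lemma lip_on_id a b : lip_on a b (fun x => x).
Proof. by exists 1 => // s t _ _; rewrite mul1r. Qed.

Lemma lip_onD a b f g :
  lip_on a b f -> lip_on a b g -> lip_on a b (fun x => f x + g x).
Proof.
move=> [L L0 fL] [L' L'0 gL]; exists (L + L'); first exact: addr_ge0.
move=> s t sab tab; rewrite opprD addrACA (le_trans (ler_normD _ _))//.
by rewrite mulrDl lerD ?fL ?gL.
Qed.

Lemma lip_onM a b f g :
  lip_on a b f -> lip_on a b g -> lip_on a b (fun x => f x * g x).
Proof.
move=> lf lg; have [C C0 fC] := lip_on_bounded lf.
have [C' C'0 gC] := lip_on_bounded lg; case: lf lg => [L L0 fL] [L' L'0 gL].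
exists (C * L' + C' * L); first by rewrite addr_ge0// mulr_ge0.
move=> s t sab tab.
have -> : f s * g s - f t * g t = f s * (g s - g t) + g t * (f s - f t) by ring.
rewrite (le_trans (ler_normD _ _))// !normrM mulrDl -!mulrA lerD//.
  by rewrite ler_pM ?fC ?gL.
by rewrite ler_pM ?gC ?fL.
Qed.

Lemma lip_onN a b f : lip_on a b f -> lip_on a b (fun x => - f x).
Proof.
move=> [L L0 fL]; exists L => // s t sab tab.
by rewrite -opprD normrN fL.
Qed.

Lemma lip_onV a b f c : 0 < c -> (forall t, a <= t <= b -> c <= f t) ->
  lip_on a b f -> lip_on a b (fun x => (f x)^-1).
Proof.
move=> c0 fc [L L0 fL]; exists (L / c ^+ 2).
  by rewrite divr_ge0// exprn_ge0// ltW.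
move=> s t sab tab.
have fs0 := lt_le_trans c0 (fc _ sab); have ft0 := lt_le_trans c0 (fc _ tab).
have -> : (f s)^-1 - (f t)^-1 = (f t - f s) / (f s * f t).
  by field; rewrite !gt_eqF.
rewrite normrM normfV (gtr0_norm (mulr_gt0 fs0 ft0)) mulrAC.
rewrite ler_pM// ?invr_ge0 ?mulr_ge0 ?(ltW fs0) ?(ltW ft0)//.
  by rewrite distrC fL.
rewrite lef_pV2 ?posrE ?exprn_gt0 ?mulr_gt0// expr2.
by rewrite ler_pM ?fc ?(ltW c0).
Qed.

Lemma MVT_le a b f f' (C : R) : {within `[a, b], continuous f} ->
  (forall t, a < t < b -> is_derive t 1 f (f' t)) ->
  (forall t, a <= t <= b -> `|f' t| <= C) ->
  forall s t, a <= s <= b -> a <= t <= b -> `|f s - f t| <= C * `|s - t|.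
Proof.
move=> fc fd f'C s t; wlog st : s t / s <= t => [H sab tab|].
  have [st|/ltW ts] := leP s t; first exact: H.
  by rewrite distrC (distrC s); apply: H.
move=> /andP[as_ sb] /andP[at_ tb].
have [x||x xst fE] := @MVT_segment R f f' s t st.
- rewrite in_itv/= => /andP[sx xt]; apply: fd.
  by rewrite (le_lt_trans as_)//= (lt_le_trans xt).
- apply: continuous_subspaceW fc => x /=; rewrite !in_itv/= => /andP[sx xt].
  by rewrite (le_trans as_)//= (le_trans xt).
- rewrite distrC fE normrM (distrC s) ler_wpM2r// f'C//.
  move: xst; rewrite in_itv/= => /andP[sx xt].
  by rewrite (le_trans as_)//= (le_trans xt).
Qed.

Lemma lip_on_derivable a b f f' (C : R) : {within `[a, b], continuous f} ->
  (forall t, a < t < b -> is_derive t 1 f (f' t)) ->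
  (forall t, a <= t <= b -> `|f' t| <= C) -> lip_on a b f.
Proof.
move=> fc fd fC; have fL := MVT_le fc fd fC; exists `|C| => // s t sab tab.
by apply: le_trans (fL _ _ sab tab) _; rewrite ler_wpM2r// ler_norm.
Qed.

(** The exponential is only locally Lipschitz; [f] is bounded by some [C] on the interval, and on
    [[-C, C]] the constant [expR C] works. *)
Lemma lip_on_expRN a b f : lip_on a b f -> lip_on a b (fun x => expR (- f x)).
Proof.
move=> lf; have [C C0 fC] := lip_on_bounded lf; case: lf => [L L0 fL].
have exp_lip (x y : R) : `|x| <= C -> `|y| <= C ->
    `|expR x - expR y| <= expR C * `|x - y|.
  rewrite ler_norml => hx; rewrite ler_norml => hy.
  apply: (@MVT_le (- C) C expR expR) => //.
  - by apply: continuous_subspaceT => x'; exact: continuous_expR.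
  - by move=> t /andP[_ tC]; rewrite ger0_norm ?expR_ge0// ler_expR.
exists (expR C * L); first by rewrite mulr_ge0 ?expR_ge0.
move=> s t sab tab; apply: le_trans (exp_lip _ _ _ _) _; rewrite ?normrN ?fC//.
by rewrite -mulrA ler_wpM2l ?expR_ge0// -opprD normrN fL.
Qed.

Lemma lip_on_comp (a b c d : R) (f v : R -> R) :
  lip_on c d f -> (forall t, a <= t <= b -> c <= v t <= d) -> lip_on a b v ->
  lip_on a b (fun t => f (v t)).
Proof.
move=> [L L0 fL] vcd [L' L'0 vL]; exists (L * L'); first exact: mulr_ge0.
move=> s t sab tab; apply: le_trans (fL _ _ (vcd _ sab) (vcd _ tab)) _.
by rewrite -mulrA ler_wpM2l// vL.
Qed.

Lemma lip_on_sum (I : Type) (r : seq I) (P : pred I) (a b : R)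
    (f : I -> R -> R) : (forall i, P i -> lip_on a b (f i)) ->
  lip_on a b (fun x => \sum_(i <- r | P i) f i x).
Proof.
move=> fP; elim: r => [|i r IH].
  rewrite [X in lip_on _ _ X](_ : _ = fun=> 0); first exact: lip_on_cst.
  by apply/funext => x; rewrite big_nil.
have [Pi|Pi] := boolP (P i); last first.
  rewrite [X in lip_on _ _ X](_ : _ = fun x => \sum_(j <- r | P j) f j x)//.
  by apply/funext => x; rewrite big_cons (negbTE Pi).
rewrite [X in lip_on _ _ X](_ : _ =
    fun x => f i x + \sum_(j <- r | P j) f j x); last first.
  by apply/funext => x; rewrite big_cons Pi.
by apply: lip_onD => //; exact: fP.
Qed.

Lemma C1lip_on_cst a b c : C1lip_on a b (fun=> c).
Proof.
split; first exact: lip_on_cst.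
by exists (fun=> 0) => [|t _]; [exact: lip_on_cst|exact: is_derive_cst].
Qed.

Lemma C1lip_on_id a b : C1lip_on a b (fun x => x).
Proof.
split; first exact: lip_on_id.
by exists (fun=> 1) => [|t _]; [exact: lip_on_cst|exact: is_derive_id].
Qed.

Lemma C1lip_onD a b f g :
  C1lip_on a b f -> C1lip_on a b g -> C1lip_on a b (fun x => f x + g x).
Proof.
move=> [lf [f' lf' ff']] [lg [g' lg' gg']]; split; first exact: lip_onD.
exists (fun x => f' x + g' x); first exact: lip_onD.
by move=> t tab; apply: is_deriveD; [exact: ff'|exact: gg'].
Qed.

Lemma C1lip_onN a b f : C1lip_on a b f -> C1lip_on a b (fun x => - f x).
Proof.
move=> [lf [f' lf' ff']]; split; first exact: lip_onN.
exists (fun x => - f' x); first exact: lip_onN.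
by move=> t tab; apply: is_deriveN; exact: ff'.
Qed.

Lemma C1lip_onM a b f g :
  C1lip_on a b f -> C1lip_on a b g -> C1lip_on a b (fun x => f x * g x).
Proof.
move=> [lf [f' lf' ff']] [lg [g' lg' gg']]; split; first exact: lip_onM.
exists (fun x => f x * g' x + g x * f' x).
  by apply: lip_onD; exact: lip_onM.
by move=> t tab; apply: is_deriveM; [exact: ff'|exact: gg'].
Qed.

Lemma C1lip_onV a b f c : 0 < c -> (forall t, a <= t <= b -> c <= f t) ->
  C1lip_on a b f -> C1lip_on a b (fun x => (f x)^-1).
Proof.
move=> c0 fc [lf [f' lf' ff']]; have lV := lip_onV c0 fc lf; split => //.
exists (fun x => - ((f x)^-1 * (f x)^-1) * f' x).
  by apply: lip_onM => //; apply: lip_onN; exact: lip_onM.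
move=> t tab; have -> : - ((f t)^-1 * (f t)^-1) * f' t = - f t ^- 2 *: f' t.
  by rewrite -expr2 exprVn.
apply: is_deriveV; last exact: ff'.
rewrite gt_eqF// (lt_le_trans c0)// fc//.
by case/andP: tab => /ltW -> /ltW ->.
Qed.

Lemma C1lip_on_expRN a b f :
  C1lip_on a b f -> C1lip_on a b (fun x => expR (- f x)).
Proof.
move=> [lf [f' lf' ff']]; have lE := lip_on_expRN lf; split => //.
exists (fun x => expR (- f x) * - f' x).
  by apply: lip_onM => //; exact: lip_onN.
move=> t tab; apply: is_derive1_comp.
by apply: is_deriveN; exact: ff'.
Qed.

Lemma C1lip_on_sum (I : Type) (r : seq I) (P : pred I) a b (f : I -> R -> R) :
  (forall i, P i -> C1lip_on a b (f i)) ->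
  C1lip_on a b (fun x => \sum_(i <- r | P i) f i x).
Proof.
move=> fP; elim: r => [|i r IH].
  rewrite [X in C1lip_on _ _ X](_ : _ = fun=> 0); first exact: C1lip_on_cst.
  by apply/funext => x; rewrite big_nil.
have [Pi|Pi] := boolP (P i); last first.
  rewrite [X in C1lip_on _ _ X](_ : _ = fun x => \sum_(j <- r | P j) f j x)//.
  by apply/funext => x; rewrite big_cons (negbTE Pi).
rewrite [X in C1lip_on _ _ X](_ : _ =
    fun x => f i x + \sum_(j <- r | P j) f j x); last first.
  by apply/funext => x; rewrite big_cons Pi.
by apply: C1lip_onD => //; exact: fP.
Qed.

(** The local error of the trapezoidal rule is of third order as soon as [w'] is Lipschitz; no
    second derivative of [w] is involved. *)
Lemma trapezoid a b phi w : {within `[a, b], continuous phi} ->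
  (forall t, a < t < b -> is_derive t 1 phi (w t)) -> C1lip_on a b w ->
  exists2 K : R, 0 <= K & forall s t, a <= s <= b -> a <= t <= b ->
    `|phi t - phi s - (t - s) * ((w s + w t) / 2)| <= K * `|t - s| ^+ 3.
Proof.
move=> phic phid [lw [w' [L L0 w'L] ww']].
exists (L / 2) => [|s t]; first by rewrite divr_ge0.
(* The quadrature error changes sign when [s] and [t] are exchanged. *)
wlog st : s t / s <= t => [H sab tab|].
  have [st|/ltW ts] := leP s t; first exact: H.
  have -> : phi t - phi s - (t - s) * ((w s + w t) / 2) =
      - (phi s - phi t - (s - t) * ((w t + w s) / 2)) by ring.
  by rewrite normrN (distrC t); exact: H.
move=> /andP[as_ sb] /andP[at_ tb].
have sub r : s <= r <= t -> a <= r <= b.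
  by move=> /andP[sr rt]; rewrite (le_trans as_)//= (le_trans rt).
have sub' r : s < r < t -> a < r < b.
  by move=> /andP[sr rt]; rewrite (le_lt_trans as_)//= (lt_le_trans rt).
have subset_st x : x <= t -> `[s, x]%classic `<=` `[a, b]%classic.
  move=> xt r /=; rewrite !in_itv/= => /andP[sr rx]; apply: sub.
  by rewrite sr (le_trans rx).
(* The error as a function of the right endpoint [r]. It vanishes at [r = s], so a quadratic bound
   on its derivative [g'] gives a cubic bound on it. *)
pose g r := phi r - phi s - (r - s) * ((w s + w r) / 2).
pose g' r := w r - ((r - s) * (w' r / 2) + (w s + w r) / 2).
have gd r : s < r < t -> is_derive r 1 g (g' r).
  move=> srt; have d1 := phid _ (sub' _ srt); have d2 := ww' _ (sub' _ srt).
  by apply: is_derive_eq; rewrite /g' /GRing.scale /=; field.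
have gc : {within `[s, t], continuous g}.
  apply: continuous_subspaceW (subset_st t _) (lip_on_continuous _) => //.
  have lphi : lip_on a b phi.
    have [C _ wC] := lip_on_bounded lw; exact: lip_on_derivable phic phid wC.
  apply: lip_onD; first by apply: lip_onD => //; exact: lip_on_cst.
  apply: lip_onN; apply: lip_onM.
    by apply: lip_onD; [exact: lip_on_id|exact: lip_on_cst].
  apply: lip_onM; last exact: lip_on_cst.
  by apply: lip_onD => //; exact: lip_on_cst.
have g'C r : s <= r <= t -> `|g' r| <= L / 2 * (t - s) ^+ 2.
  move=> /[dup] srt /andP[sr rt].
  have [x||x xsr wE] := @MVT_segment R w w' s r sr.
  - rewrite in_itv/= => /andP[sx xr]; apply: ww'; apply: sub'.
    by rewrite sx (lt_le_trans xr).
  - by apply: continuous_subspaceW (lip_on_continuous lw); exact: subset_st.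
  - move: xsr; rewrite in_itv/= => /andP[sx xr].
    (* With the mean value point [x], [g'] becomes [(w' x - w' r) (r - s) / 2], where the Lipschitz
       bound on [w'] yields a second factor of order [t - s]. *)
    have wrE : w r = w' x * (r - s) + w s by rewrite -wE subrK.
    have -> : g' r = (w' x - w' r) / 2 * (r - s) by rewrite /g' wrE; field.
    have xab : a <= x <= b by apply: sub; rewrite sx (le_trans xr).
    have := w'L _ _ xab (sub _ srt); rewrite (distrC x).
    rewrite (@ger0_norm _ (r - x)) ?subr_ge0// => h.
    rewrite 2!normrM normfV (@ger0_norm _ 2)//.
    rewrite (@ger0_norm _ (r - s)) ?subr_ge0//.
    have h' : `|w' x - w' r| <= L * (t - s).
      by apply: le_trans h _; rewrite ler_wpM2l// lerB.
    have : `|w' x - w' r| * (r - s) <= L * (t - s) * (t - s).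
      by apply: ler_pM => //; rewrite ?subr_ge0// lerB.
    by rewrite expr2; lra.
have sst : s <= s <= t by rewrite lexx.
have tst : s <= t <= t by rewrite lexx st.
have := MVT_le gc gd g'C tst sst.
rewrite {2}/g !subrr mul0r subr0 subr0.
rewrite (ger0_norm (_ : 0 <= t - s)) ?subr_ge0// => /le_trans; apply.
by rewrite -mulrA -exprSr.
Qed.

End lipschitz_classes.

(** * The blob profile and its divided difference *)

Section blob_profile.
Context {R : realType}.
Implicit Types (a b c t : R) (m : nat).

Lemma continuous_expRN_div t : 0 < t ->
  {for t, continuous (fun u : R => expR (- u) / u)}.
Proof.
move=> t0.
apply: (@differentiable_continuous _ _ _ _ (fun u : R => expR (- u) / u)).
apply/derivable1_diffP.
have d1 : is_derive t 1 (fun u : R => expR (- u)) (expR (- t) * -1).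
  exact: is_derive1_comp.
have d2 : is_derive t 1 (fun u : R => u^-1) (- t ^- 2 *: 1).
  by apply: is_deriveV; rewrite gt_eqF.
by apply: ex_derive; apply: is_deriveM.
Qed.

(** On [u >= c] the integrand is dominated by [1 / c] times the exponential density of rate 1. *)
Lemma integrable_expRN_div c : 0 < c ->
  lebesgue_measure.-integrable `[c, +oo[
    (EFin \o (fun u : R => expR (- u) / u)).
Proof.
move=> c0.
have int_exp : lebesgue_measure.-integrable `[c, +oo[
    (fun u => c^-1%:E * (EFin \o exponential_pdf (1 : R)) u)%E.
  apply: integrableZl => //.
  by apply: integrableS (integrable_exponential_pdf _).
apply: (le_integrable _ _ _ int_exp) => //.
- apply/measurable_EFinP; apply: subspace_continuous_measurable_fun => //.
  apply/subspace_continuousP => x /=; rewrite in_itv/= andbT => cx.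
  apply: cvg_within_filter; apply: continuous_expRN_div.
  exact: lt_le_trans cx.
- move=> x /=; rewrite in_itv/= andbT => cx; have x0 := lt_le_trans c0 cx.
  rewrite exponential_pdfE ?(ltW x0)// mul1r mulN1r.
  rewrite lee_fin !ger0_norm ?mulr_ge0 ?expR_ge0 ?invr_ge0 ?(ltW x0)
    ?(ltW c0)// mulrC.
  by rewrite ler_wpM2r ?expR_ge0// lef_pV2.
Qed.

(** The fundamental theorem is applied with a fixed base point [c = t / 2]: for [u] near [t], [E1 u]
    is [E1 c] minus the integral from [c] to [u]. The endpoint included in the definition of [E1]
    has measure zero. *)
Lemma is_derive_E1 t : 0 < t -> is_derive t 1 E1 (- (expR (- t) / t)).
Proof.
move=> t0; pose c := t / 2; have c0 : 0 < c by rewrite divr_gt0.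
have ct : c < t by rewrite /c ltr_pdivrMr//; lra.
pose f u : R := expR (- u) / u.
have fint := integrable_expRN_div c0.
have [] := @continuous_FTC1_closed R f c t (t + 1).
- by rewrite ltrDl.
- apply: integrableS fint => //.
  by move=> x /=; rewrite !in_itv/= andbT => /andP[].
- exact: ct.
- exact: continuous_expRN_div.
set F := fun x : R => _; rewrite derive1E => dF FE.
have : is_derive t 1 (fun x => E1 c - F x) (- f t).
  rewrite -(sub0r (f t)) -FE.
  by apply: is_deriveB; exact/derivableP.
apply: near_eq_is_derive.
have : \forall u \near t, c < u by exact: lt_nbhsr.
apply: filterS => u cu; rewrite /E1 /F -/f.
have cubound : lebesgue_measure.-integrable `[u, +oo[ (EFin \o f).
  exact/integrable_expRN_div/(lt_trans c0).
have -> : \int[lebesgue_measure]_(x in `[u, +oo[) f x =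
          \int[lebesgue_measure]_(x in `]u, +oo[) f x.
  rewrite Rintegral_itv_obnd_cbnd//; apply: integrableS cubound => //.
  by move=> x /=; rewrite !in_itv/= !andbT => /ltW.
by rewrite -(@Rintegral_itvB R f (BLeft c) +oo%O u)// bnd_simp ltW.
Qed.

Definition blob_profile m t := (1 - Q m t * expR (- t)) / t.

Definition blob_exp_factor m t : R :=
  match m with 2%N => 0 | 4%N => -1 | _ => t / 2 - 3 / 2 end.

Definition blob_primitive m t := ln t + E1 t + blob_exp_factor m t * expR (- t).

(** The derivatives of [ln] and [E1] add up to [(1 - e^(-t)) / t]. What remains is
    [q' - q = (1 - Q) / t], with both sides equal to 0, 1 and [2 - t / 2] for m = 2, 4, 6. *)
Lemma is_derive_blob_primitive m t : m \in [:: 2; 4; 6]%N -> 0 < t ->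
  is_derive t 1 (blob_primitive m) (blob_profile m t).
Proof.
move=> hm t0; have d1 := is_derive1_ln t0; have d2 := is_derive_E1 t0.
have tN0 : t != 0 by rewrite gt_eqF.
rewrite /blob_primitive /blob_profile.
move: hm; rewrite !inE => /or3P[]/eqP-> /=.
- by apply: is_derive_eq; rewrite /GRing.scale/=; field.
- by apply: is_derive_eq; rewrite /GRing.scale/=; field.
- by apply: is_derive_eq; rewrite /GRing.scale/=; field.
Qed.

(** The scheme divides the coefficient by the squared old distance, which is [delta^2 a]. Absorbing
    this [a] turns the coefficient into a quantity symmetric in [a] and [b]. *)
Definition blob_quotient m a b := blob_coef m a b / a.

Lemma blob_quotientxx m a : blob_quotient m a a = blob_profile m a.
Proof. by rewrite /blob_quotient /blob_coef eqxx. Qed.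

(** The prefactor becomes [1 / (b - a)]. For m = 6 the separate term contributes
    [(b - a) e^(-b) / 2] to the numerator, which changes [(a / 2 - 3 / 2) e^(-b)] into
    [(b / 2 - 3 / 2) e^(-b)]. *)
Lemma blob_quotientE m a b : m \in [:: 2; 4; 6]%N -> 0 < a -> 0 < b -> b != a ->
  blob_quotient m a b = (blob_primitive m b - blob_primitive m a) / (b - a).
Proof.
move=> hm a0 b0 ba; rewrite /blob_quotient /blob_coef (negbTE ba).
have ba0 : b - a != 0 by rewrite subr_eq0.
have aN0 : a != 0 by rewrite gt_eqF.
rewrite gtr0_norm ?divr_gt0// ln_div ?posrE//.
have eb : expR (- a) * (expR (- (b - a)) - 1) = expR (- b) - expR (- a).
  by rewrite mulrBr mulr1 -expRD; congr (expR _ - _); ring.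
rewrite eb /blob_primitive.
by move: hm; rewrite !inE => /or3P[]/eqP->; rewrite /blob_exp_factor; field;
  rewrite aN0 ba0.
Qed.

Lemma blob_quotientC m a b : m \in [:: 2; 4; 6]%N -> 0 < a -> 0 < b ->
  blob_quotient m a b = blob_quotient m b a.
Proof.
move=> hm a0 b0; have [->//|ba] := eqVneq b a.
rewrite !blob_quotientE// 1?eq_sym// -mulrNN -invrN !opprB//.
Qed.

(** Expresses the quotient as the mean of the profile over the segment from [a] to [b] through an
    antiderivative on [0, 1]. The cases [a = b] and [a <> b] are thereby unified, and no estimate
    has to treat the singular denominator [b - a] again. *)
Lemma blob_quotient_param m a b : m \in [:: 2; 4; 6]%N -> 0 < a -> 0 < b ->
  exists2 A : R -> R,
    forall s : R, 0 <= s <= 1 ->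
      is_derive s 1 A (blob_profile m (a + s * (b - a))) &
    blob_quotient m a b = A 1 - A 0.
Proof.
move=> hm a0 b0; have [->|ba] := eqVneq b a.
  exists (fun s => s * blob_profile m a); last first.
    by rewrite mul1r mul0r subr0 blob_quotientxx.
  move=> s _; rewrite subrr mulr0 addr0.
  by apply: is_derive_eq; rewrite /GRing.scale/=; ring.
have ba0 : b - a != 0 by rewrite subr_eq0.
exists (fun s => blob_primitive m (a + s * (b - a)) / (b - a)); last first.
  rewrite blob_quotientE// mul1r mul0r addr0 mulrBl.
  congr (blob_primitive _ _ / _ - _).
  by ring.
move=> s /andP[s0 s1].
have p0 : 0 < a + s * (b - a).
  have -> : a + s * (b - a) = (1 - s) * a + s * b by ring.
  have [->|sN1] := eqVneq s 1; first by rewrite subrr mul0r add0r mul1r.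
  rewrite ltr_pwDl// ?mulr_ge0 ?(ltW b0)// mulr_gt0// subr_gt0 lt_neqAle sN1//.
have d1 : is_derive s 1 (fun s => a + s * (b - a)) (b - a).
  by apply: is_derive_eq; rewrite /GRing.scale/=; ring.
have d3 : is_derive s 1 (fun s => blob_primitive m (a + s * (b - a)))
  (blob_profile m (a + s * (b - a)) * (b - a)).
  exact: (@is_derive1_comp R (blob_primitive m) (fun s => a + s * (b - a)) s _ _
    (is_derive_blob_primitive hm p0) d1).
apply: is_derive_eq; rewrite /GRing.scale/=.
by field.
Qed.

(** The numerator vanishes to first order at 0: [1 - e <= t], and both [t e] and [t^2 e] are at most
    [t], the latter because [t e <= 1]. The constant 4 serves all three orders and does not depend
    on a lower bound for [t]. *)
Lemma blob_profile_le m t : m \in [:: 2; 4; 6]%N -> 0 < t ->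
  `|blob_profile m t| <= 4.
Proof.
move=> hm t0; set e := expR (- t).
have e0 : 0 < e by exact: expR_gt0.
have e1 : e <= 1 by rewrite -expR0 ler_expR oppr_le0 ltW.
have et : 1 - t <= e by rewrite expR_ge1Dx.
have te : t * e <= 1.
  rewrite /e expRN ler_pdivrMr ?expR_gt0// mul1r.
  by apply: le_trans (expR_ge1Dx t); rewrite lerDr.
have te0 : 0 <= t * e by rewrite mulr_ge0 ?ltW.
have tet : t * e <= t by rewrite ler_piMr// ltW.
have tte0 : 0 <= t * (t * e) by rewrite mulr_ge0// ltW.
have ttet : t * (t * e) <= t by rewrite ler_piMr// ltW.
rewrite normrM normfV (gtr0_norm t0) ler_pdivrMr// ler_norml.
move: hm; rewrite !inE => /or3P[]/eqP->; rewrite /Q -/e ?expr2;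
  apply/andP; split; lra.
Qed.

Lemma C1lip_on_blob_profile m a b c (v : R -> R) : m \in [:: 2; 4; 6]%N ->
  0 < c -> (forall t, a <= t <= b -> c <= v t) -> C1lip_on a b v ->
  C1lip_on a b (fun t => blob_profile m (v t)).
Proof.
move=> hm c0 vc lv; apply: C1lip_onM; last exact: (C1lip_onV c0 vc lv).
apply: C1lip_onD; first exact: C1lip_on_cst.
apply/C1lip_onN/C1lip_onM; last exact: C1lip_on_expRN.
move: hm; rewrite !inE => /or3P[]/eqP->; rewrite /Q.
- exact: C1lip_on_cst.
- by apply: C1lip_onD; [exact: C1lip_on_cst|exact: C1lip_onN].
- apply: C1lip_onD.
    apply: C1lip_onD; first exact: C1lip_on_cst.
    by apply: C1lip_onN; apply: C1lip_onM => //; exact: C1lip_on_cst.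
  apply: C1lip_onM; last exact: C1lip_on_cst.
  by under eq_fun do rewrite expr2; exact: C1lip_onM.
Qed.

Lemma convex_itv a b x y s : a <= x <= b -> a <= y <= b -> 0 <= s <= 1 ->
  a <= x + s * (y - x) <= b.
Proof. by move=> /andP[? ?] /andP[? ?] /andP[? ?]; apply/andP; split; nra. Qed.

Lemma blob_quotient_le m a b : m \in [:: 2; 4; 6]%N -> 0 < a -> 0 < b ->
  `|blob_quotient m a b| <= 4.
Proof.
move=> hm a0 b0; have [A dA ->] := blob_quotient_param hm a0 b0.
have Ac : {within `[0, 1], continuous A}.
  apply: derivable_within_continuous => x; rewrite in_itv/= => x01.
  by have := dA _ x01.
(* The constant is written as [4 * |1 - 0|] to match the mean value inequality on [0, 1]. *)
rewrite -[4]mulr1 -[X in _ <= 4 * X](@normr1 R) -[X in _ <= 4 * `|X|](subr0 1).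
apply: (MVT_le Ac (f' := fun s => blob_profile m (a + s * (b - a)))) => //.
- by move=> s /andP[/ltW s0 /ltW s1]; apply: dA; rewrite s0.
- move=> s s01; apply: blob_profile_le => //.
  have m0 : 0 < Num.min a b by rewrite lt_min a0.
  have /andP[h _] : Num.min a b <= a + s * (b - a) <= Num.max a b.
    by apply: convex_itv => //; rewrite ?ge_min ?le_max !lexx ?orbT.
  exact: lt_le_trans h.
- by rewrite lexx ler01.
- by rewrite lexx ler01.
Qed.

(** The two means are compared at equal parameter [s]: the evaluation points differ by
    [(1 - s) (a - a') + s (b - b')], so a Lipschitz constant of the profile on [[c, d]] serves for
    the quotient too. *)
Lemma blob_quotient_lip m c d : m \in [:: 2; 4; 6]%N -> 0 < c ->
  exists2 L : R, 0 <= L & forall a b a' b', c <= a <= d -> c <= b <= d ->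
    c <= a' <= d -> c <= b' <= d ->
    `|blob_quotient m a b - blob_quotient m a' b'| <=
      L * (`|a - a'| + `|b - b'|).
Proof.
move=> hm c0.
have [[L L0 profL] _] : C1lip_on c d (blob_profile m).
  apply: (@C1lip_on_blob_profile _ _ _ c id) => //; last exact: C1lip_on_id.
  by move=> t /andP[].
exists L => // a b a' b' ha hb ha' hb'.
have pos x : c <= x <= d -> 0 < x by move=> /andP[? _]; exact: lt_le_trans c0 _.
have [A dA ->] := blob_quotient_param hm (pos _ ha) (pos _ hb).
have [A' dA' ->] := blob_quotient_param hm (pos _ ha') (pos _ hb').
pose D s := A s - A' s.
have dD (s : R) : 0 <= s <= 1 -> is_derive s 1 D
    (blob_profile m (a + s * (b - a)) - blob_profile m (a' + s * (b' - a'))).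
  by move=> s01; apply: is_deriveB; [exact: dA|exact: dA'].
have Dc : {within `[0, 1], continuous D}.
  apply: derivable_within_continuous => x; rewrite in_itv/= => x01.
  by have := dD _ x01.
have -> : A 1 - A 0 - (A' 1 - A' 0) = D 1 - D 0 by rewrite /D; ring.
rewrite -[leRHS]mulr1 -[X in _ <= _ * X](@normr1 R).
rewrite -[X in _ <= _ * `|X|](subr0 1).
apply: (MVT_le Dc) => //.
- by move=> s /andP[/ltW s0 /ltW s1]; apply: dD; rewrite s0.
- move=> s s01; apply: le_trans (profL _ _ _ _) _; try exact: convex_itv.
  rewrite ler_wpM2l//; have /andP[s0 s1] := s01.
  have -> : a + s * (b - a) - (a' + s * (b' - a')) =
    (1 - s) * (a - a') + s * (b - b') by ring.
  rewrite (le_trans (ler_normD _ _))// !normrM.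
  rewrite (ger0_norm s0) (@ger0_norm _ (1 - s)) ?subr_ge0//.
  by rewrite lerD// ler_piMl//; lra.
- by rewrite lexx ler01.
- by rewrite lexx ler01.
Qed.

(** This is the trapezoidal estimate for the primitive, divided by [|b - a|]. *)
Lemma blob_quotient_trapezoid m c d : m \in [:: 2; 4; 6]%N -> 0 < c ->
  exists2 K : R, 0 <= K & forall a b, c <= a <= d -> c <= b <= d ->
    `|blob_quotient m a b - (blob_profile m a + blob_profile m b) / 2| <=
      K * `|b - a| ^+ 2.
Proof.
move=> hm c0.
have pos x : c <= x <= d -> 0 < x by move=> /andP[? _]; exact: lt_le_trans c0 _.
have profL : C1lip_on c d (blob_profile m).
  apply: (@C1lip_on_blob_profile _ _ _ c id) => //; last exact: C1lip_on_id.
  by move=> t /andP[].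
have [||K K0 trap] :=
  @trapezoid R c d (blob_primitive m) (blob_profile m) _ _ profL.
- apply: derivable_within_continuous => x; rewrite in_itv/= => /pos x0.
  by have := is_derive_blob_primitive hm x0.
- move=> t /andP[ct _]; apply: is_derive_blob_primitive => //.
  exact: lt_trans ct.
exists K => // a b ha hb; have [->|ba] := eqVneq b a.
  rewrite blob_quotientxx (_ : (_ + _) / 2 = blob_profile m a); last by field.
  by rewrite !subrr normr0 mulr_ge0// exprn_ge0.
have ba0 : 0 < `|b - a| by rewrite normr_gt0 subr_eq0.
rewrite -(ler_pM2l ba0) -normrM.
rewrite blob_quotientE ?pos// mulrBr mulrCA divff ?mulr1 ?subr_eq0//.
apply: le_trans (trap _ _ ha hb) _.
by rewrite exprS mulrCA.
Qed.

Lemma blob_profile_lip m (a b c d : R) (v : R -> R) :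
  m \in [:: 2; 4; 6]%N -> 0 < c -> (forall t, a <= t <= b -> c <= v t <= d) ->
  lip_on a b v -> lip_on a b (fun t => blob_profile m (v t)).
Proof.
move=> hm c0 vcd lv; apply: lip_on_comp vcd lv.
have [] // : C1lip_on c d (blob_profile m).
apply: (@C1lip_on_blob_profile _ _ _ c id) => //; last exact: C1lip_on_id.
by move=> t /andP[].
Qed.

(** Besides the quadrature error of the quotient, the mean of a product differs from the product of
    the means by a quarter of the product of the two increments, each of first order. *)
Lemma pair_quadrature m (a b c d : R) (u v : R -> R) :
  m \in [:: 2; 4; 6]%N -> 0 < c -> (forall t, a <= t <= b -> c <= v t <= d) ->
  lip_on a b u -> lip_on a b v ->
  exists2 K : R, 0 <= K & forall s t, a <= s <= b -> a <= t <= b ->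
    `|(u t + u s) / 2 * blob_quotient m (v s) (v t) -
      (u s * blob_profile m (v s) + u t * blob_profile m (v t)) / 2| <=
    K * `|t - s| ^+ 2.
Proof.
move=> hm c0 vcd lu lv.
have [U U0 uU] := lip_on_bounded lu.
have [Kq Kq0 qtrap] := @blob_quotient_trapezoid m c d hm c0.
have [Lp Lp0 pL] := blob_profile_lip hm c0 vcd lv.
case: lu lv => [Lu Lu0 uL] [Lv Lv0 vL].
exists (U * (Kq * Lv ^+ 2) + Lu * Lp).
  by rewrite addr_ge0 ?mulr_ge0 ?sqr_ge0.
move=> s t sab tab; set q := blob_quotient _ _ _.
set ps := blob_profile m (v s); set pt := blob_profile m (v t).
have hq : `|q - (ps + pt) / 2| <= Kq * Lv ^+ 2 * `|t - s| ^+ 2.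
  apply: le_trans (qtrap _ _ (vcd _ sab) (vcd _ tab)) _.
  rewrite -mulrA ler_wpM2l// -exprMn lerXn2r ?nnegrE ?mulr_ge0//.
  exact: vL.
have hU : `|(u t + u s) / 2| <= U.
  rewrite normrM normfV (@ger0_norm _ 2)// ler_pdivrMr//.
  rewrite (le_trans (ler_normD _ _))//.
  by have := uU _ sab; have := uU _ tab; lra.
have -> : (u t + u s) / 2 * q - (u s * ps + u t * pt) / 2 =
  (u t + u s) / 2 * (q - (ps + pt) / 2) - (u t - u s) * ((pt - ps) / 4).
  by field.
rewrite (le_trans (ler_normB _ _))// [leRHS]mulrDl; apply: lerD.
  by rewrite normrM -mulrA; apply: ler_pM.
rewrite normrM expr2 mulrACA; apply: ler_pM => //; first exact: uL.
apply: le_trans (pL _ _ tab sab).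
rewrite normrM normfV (@ger0_norm _ 4)// ler_pdivrMr//.
by have := normr_ge0 (pt - ps); lra.
Qed.

End blob_profile.

(** * The vortex-blob scheme *)

(** The sum of nonnegative constants dominates each of them, and monotonicity in the constant does
    the rest. *)
Lemma uniform_bound_ord (R : realType) (n : nat) (P : 'I_n -> R -> Prop) :
  (forall i K K', K <= K' -> P i K -> P i K') ->
  (forall i, exists2 K, 0 <= K & P i K) ->
  exists2 K, 0 <= K & forall i, P i K.
Proof.
move=> Pmono Pex.
have /choice[f fP] : forall i, exists K, 0 <= K /\ P i K.
  by move=> i; have [K] := Pex i; exists K.
exists (\sum_i f i) => [|i]; first by apply: sumr_ge0 => i _; case: (fP i).
apply: Pmono (proj2 (fP i)); rewrite (bigD1 i)//= lerDl.
by apply: sumr_ge0 => j _; case: (fP j).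
Qed.

(** * Norms, relative positions and squared distances of configurations *)

Section configurations.
Context {R : realType} {M : nat}.
Implicit Types (z w : config R M) (i j : 'I_M).

Lemma config_coord_le z i : `|z.1 0 i| <= `|z| /\ `|z.2 0 i| <= `|z|.
Proof.
have coord (n : nat) (v : 'rV[R]_n) k : `|v 0 k| <= `|v|.
  by rewrite [leRHS]/Num.norm/= mx_normrE; apply: (le_bigmax _ _ (0, k)).
rewrite prod_normE; split; apply: le_trans (coord _ _ i) _.
  by rewrite le_max lexx.
by rewrite le_max lexx orbT.
Qed.

Lemma config_norm_le z (C : R) : 0 <= C ->
  (forall i, `|z.1 0 i| <= C) -> (forall i, `|z.2 0 i| <= C) -> `|z| <= C.
Proof.
move=> C0 z1 z2.
have row (v : 'rV[R]_M) : (forall i, `|v 0 i| <= C) -> `|v| <= C.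
  move=> vC; rewrite [leLHS]/Num.norm/= mx_normrE; apply/bigmax_leP; split=> //.
  by move=> [k l] _ /=; rewrite ord1.
by rewrite prod_normE ge_max !row.
Qed.

Lemma dxB z w i j : dx (z - w) i j = dx z i j - dx w i j.
Proof. by rewrite /dx !mxE; ring. Qed.

Lemma dyB z w i j : dy (z - w) i j = dy z i j - dy w i j.
Proof. by rewrite /dy !mxE; ring. Qed.

Lemma dx_le z i j : `|dx z i j| <= 2 * `|z|.
Proof.
rewrite (le_trans (ler_normB _ _))// mulr2n mulrDl mul1r.
by apply: lerD; case: (config_coord_le z i); case: (config_coord_le z j).
Qed.

Lemma dy_le z i j : `|dy z i j| <= 2 * `|z|.
Proof.
rewrite (le_trans (ler_normB _ _))// mulr2n mulrDl mul1r.
by apply: lerD; case: (config_coord_le z i); case: (config_coord_le z j).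
Qed.

Lemma xiE (delta : R) z i j :
  xi delta z i j = (dx z i j ^+ 2 + dy z i j ^+ 2) / delta ^+ 2.
Proof. by rewrite /xi expr_div_n /dist sqr_sqrtr// addr_ge0 ?sqr_ge0. Qed.

Lemma dist_sqr (delta : R) z i j : delta != 0 ->
  dist z i j ^+ 2 = delta ^+ 2 * xi delta z i j.
Proof. by move=> d0; rewrite /xi expr_div_n mulrCA divff ?mulr1 ?expf_neq0. Qed.

Lemma xi_gt0 (delta : R) z i j : 0 < delta -> distinct_positions z -> j != i ->
  0 < xi delta z i j.
Proof.
by move=> d0 dz ji; rewrite exprn_gt0// divr_gt0//; apply: dz; rewrite eq_sym.
Qed.

Lemma distinct_positions_xi (delta : R) z : 0 < delta ->
  (forall i j, j != i -> 0 < xi delta z i j) -> distinct_positions z.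
Proof.
move=> d0 xz i j ij; have /xz xij : j != i by rewrite eq_sym.
rewrite lt_neqAle sqrtr_ge0 andbT eq_sym.
by apply: contraTneq xij => dist0; rewrite /xi dist0 mul0r expr0n/= ltxx.
Qed.

(** Each squared coordinate difference factors into a difference of size [2 |z - w|] and a sum of
    size [4 W]; the two coordinates together give 16. *)
Lemma xi_lip (delta W : R) z w i j : `|z| <= W -> `|w| <= W ->
  `|xi delta z i j - xi delta w i j| <= 16 * W / delta ^+ 2 * `|z - w|.
Proof.
move=> zW wW; rewrite !xiE -mulrBl normrM normfV.
rewrite (@ger0_norm _ (delta ^+ 2)) ?sqr_ge0//.
rewrite [leRHS]mulrAC ler_wpM2r ?invr_ge0 ?sqr_ge0//.
have W0 : 0 <= W by apply: le_trans zW.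
have sq (x y : R) : `|x| <= 2 * `|z| -> `|y| <= 2 * `|w| ->
    `|x - y| <= 2 * `|z - w| -> `|x ^+ 2 - y ^+ 2| <= 8 * W * `|z - w|.
  move=> hx hy hxy; rewrite subr_sqr normrM.
  have hs : `|x + y| <= 4 * W by rewrite (le_trans (ler_normD _ _))//; lra.
  have := ler_pM (normr_ge0 _) (normr_ge0 _) hxy hs; lra.
have -> : dx z i j ^+ 2 + dy z i j ^+ 2 - (dx w i j ^+ 2 + dy w i j ^+ 2) =
  (dx z i j ^+ 2 - dx w i j ^+ 2) + (dy z i j ^+ 2 - dy w i j ^+ 2) by ring.
rewrite (le_trans (ler_normD _ _))//.
have h1 : `|dx z i j ^+ 2 - dx w i j ^+ 2| <= 8 * W * `|z - w|.
  by apply: sq; rewrite -?dxB; exact: dx_le.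
have h2 : `|dy z i j ^+ 2 - dy w i j ^+ 2| <= 8 * W * `|z - w|.
  by apply: sq; rewrite -?dyB; exact: dy_le.
by lra.
Qed.

Lemma xi_le (delta W : R) z i j : `|z| <= W ->
  xi delta z i j <= 16 * W ^+ 2 / delta ^+ 2.
Proof.
move=> zW; have W0 : 0 <= W by apply: le_trans zW.
have := @xi_lip delta W z 0 i j zW; rewrite normr0 => /(_ W0).
have -> : xi delta (0 : config R M) i j = 0.
  by rewrite xiE /dx /dy /= !mxE subrr expr0n/= addr0 mul0r.
rewrite !subr0 => h.
apply: le_trans (ler_norm _) _; apply: le_trans h _.
by rewrite expr2 mulrA [leRHS]mulrAC ler_wpM2l// divr_ge0 ?sqr_ge0// mulr_ge0.
Qed.

End configurations.

(** * The scheme as an implicit rule: symmetry, growth and Lipschitz bounds *)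

Section scheme.
Context {R : realType} (m M : nat) (h delta : R) (omega : 'I_M -> R).
Hypothesis hm : m \in [:: 2; 4; 6]%N.
Hypothesis delta_gt0 : 0 < delta.
Implicit Types (z w : config R M) (i j : 'I_M).

Let d0 : delta != 0. Proof. by rewrite gt_eqF. Qed.

Let pi0 : pi != 0 :> R. Proof. by rewrite gt_eqF// pi_gt0. Qed.

(** The factor [delta^2] comes from writing a squared distance as [delta^2 xi]. *)
Definition strength : R := h ^+ 2 / (2 * pi * delta ^+ 2).
Definition total_omega : R := \sum_j `|omega j|.

Lemma strength_ge0 : 0 <= strength.
Proof.
by rewrite divr_ge0 ?sqr_ge0// mulr_ge0 ?sqr_ge0// mulr_ge0// pi_ge0.
Qed.

Lemma total_omega_ge0 : 0 <= total_omega.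
Proof. exact: sumr_ge0. Qed.

Lemma omega_sum_le i (f : 'I_M -> R) (C : R) : 0 <= C ->
  (forall j, j != i -> `|f j| <= C) ->
  `|\sum_(j < M | j != i) omega j * f j| <= total_omega * C.
Proof.
move=> C0 fC; rewrite (le_trans (ler_norm_sum _ _ _))// mulr_suml.
rewrite [leRHS](bigID (fun j => j != i))/= ler_wpDr//.
  by apply: sumr_ge0 => j _; rewrite mulr_ge0.
by apply: ler_sum => j ji; rewrite normrM ler_wpM2l// fC.
Qed.

(** The parameter [g] stands for [dx] or [dy], so that both components of the field share their
    estimates. *)
Definition pair_sum (g : config R M -> 'I_M -> 'I_M -> R) z z' i : R :=
  \sum_(j < M | j != i) omega j *
    ((g z' i j + g z i j) / 2 *
     blob_quotient m (xi delta z i j) (xi delta z' i j)).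

Definition pair_flow (g : config R M -> 'I_M -> 'I_M -> R) z i : R :=
  \sum_(j < M | j != i) omega j * (g z i j * blob_profile m (xi delta z i j)).

Lemma velocity_sumE (g : config R M -> 'I_M -> 'I_M -> R) z i :
  distinct_positions z ->
  h ^+ 2 / (2 * pi) * (\sum_(j < M | j != i) omega j *
    (g z i j / dist z i j ^+ 2) *
    (1 - Q m (dist z i j ^+ 2 / delta ^+ 2) *
         expR (- (dist z i j ^+ 2 / delta ^+ 2)))) =
  strength * pair_flow g z i.
Proof.
move=> dz; rewrite /pair_flow !mulr_sumr; apply: eq_bigr => j ji.
have x0 : xi delta z i j != 0 by rewrite gt_eqF// xi_gt0.
rewrite (_ : dist z i j ^+ 2 / delta ^+ 2 = xi delta z i j); last first.
  by rewrite /xi expr_div_n.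
rewrite (dist_sqr _ _ _ d0) /strength /blob_profile.
by move: pi0; generalize (pi : R) => p p0; field; rewrite x0 d0.
Qed.

Definition scheme_field z z' : config R M :=
  (\row_i (- strength * pair_sum dy z z' i),
   \row_i (strength * pair_sum dx z z' i)).

Lemma blob_schemeE (tau : R) z z' : tau != 0 ->
  blob_scheme m h delta omega tau z z' <->
  [/\ distinct_positions z, distinct_positions z' &
      z' = z + tau *: scheme_field z z'].
Proof.
move=> tau0.
have sumE (g : config R M -> 'I_M -> 'I_M -> R) i : distinct_positions z ->
    h ^+ 2 / (2 * pi) * (\sum_(j < M | j != i) omega j *
      ((g z' i j + g z i j) / 2 / dist z i j ^+ 2) *
         blob_coef m (xi delta z i j) (xi delta z' i j)) =
    strength * pair_sum g z z' i.
  move=> dz; rewrite !mulr_sumr; apply: eq_bigr => j ji.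
  have x0 : xi delta z i j != 0 by rewrite gt_eqF// xi_gt0.
  rewrite (dist_sqr _ _ _ d0) /strength /blob_quotient.
  by move: pi0; generalize (pi : R) => p p0; field; rewrite x0 d0.
have stepE (a b c : R) : (a - b) / tau - c = 0 <-> a = b + tau * c.
  split=> [/eqP|->]; last by field.
  by rewrite subr_eq0 => /eqP <-; field.
split=> [[_ dz dz' eqs]|[dz dz' zE]]; split=> //.
- case: z z' dz dz' eqs sumE => [x y] [x' y'] dz dz' eqs sumE.
  congr pair; apply/rowP => i; rewrite !mxE; have [ex ey] := eqs i.
    by apply/stepE; rewrite mulNr opprK -(sumE dy).
  by apply/stepE; rewrite -(sumE dx).
- move=> i; rewrite /mean_dx /mean_dy !sumE//.
  have e1 : z'.1 0 i = z.1 0 i + tau * (- strength * pair_sum dy z z' i).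
    by rewrite {1}zE !mxE.
  have e2 : z'.2 0 i = z.2 0 i + tau * (strength * pair_sum dx z z' i).
    by rewrite {1}zE !mxE.
  split; last by rewrite e2; exact/stepE.
  by rewrite e1; field.
Qed.

(** The field is invariant under exchange of its arguments, because the means and the divided
    differences are; then [z' = z + tau F] and [z = z' - tau F] are the same equation. *)
Lemma blob_scheme_symmetric : symmetric_method (blob_scheme m h delta omega).
Proof.
have field_sym z z' : distinct_positions z -> distinct_positions z' ->
    scheme_field z z' = scheme_field z' z.
  move=> dz dz'; have ps g i : pair_sum g z z' i = pair_sum g z' z i.
    apply: eq_bigr => j ji; rewrite addrC blob_quotientC//; exact: xi_gt0.
  by congr pair; apply/rowP => i; rewrite !mxE ps.
(* At [tau = 0] both relations are empty, since the scheme requires a nonzero step. *)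
move=> tau z z'; rewrite /adjoint; have [->|tau0] := eqVneq tau 0.
  by rewrite oppr0; split=> -[]; rewrite eqxx.
rewrite !blob_schemeE ?oppr_eq0//; split=> -[dz dz' zE]; split=> //.
  apply/eqP; rewrite -subr_eq -scaleNr field_sym//.
  by apply/eqP; exact: esym.
apply/eqP; rewrite scaleNr eq_sym subr_eq field_sym//.
exact/eqP.
Qed.

Lemma pair_sum_le (g : config R M -> 'I_M -> 'I_M -> R) z z' i :
  (forall w i j, `|g w i j| <= 2 * `|w|) ->
  distinct_positions z -> distinct_positions z' ->
  `|pair_sum g z z' i| <= total_omega * (4 * (`|z| + `|z'|)).
Proof.
move=> gle dz dz'; apply: omega_sum_le; first by rewrite mulr_ge0// addr_ge0.
move=> j ji; rewrite normrM mulrC.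
apply: ler_pM => //; first by apply: blob_quotient_le => //; exact: xi_gt0.
rewrite normrM normfV (@ger0_norm _ 2)// ler_pdivrMr//.
rewrite (le_trans (ler_normD _ _))//.
by have := gle z i j; have := gle z' i j; lra.
Qed.

(** The bound 4 on the quotient does not deteriorate as vortices approach each other, so the growth
    estimate holds for all distinct positions. *)
Lemma scheme_field_le z z' : distinct_positions z -> distinct_positions z' ->
  `|scheme_field z z'| <= strength * total_omega * 4 * (`|z| + `|z'|).
Proof.
move=> dz dz'; have s0 := strength_ge0; have o0 := total_omega_ge0.
apply: config_norm_le => [|i|i] /=.
- by rewrite mulr_ge0 ?addr_ge0// mulr_ge0// mulr_ge0.
- rewrite mxE normrM normrN (ger0_norm s0) -2!mulrA ler_wpM2l//.
  by apply: pair_sum_le => //; exact: dy_le.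
- rewrite mxE normrM (ger0_norm s0) -2!mulrA ler_wpM2l//.
  by apply: pair_sum_le => //; exact: dx_le.
Qed.

(** Here every [xi] with [j != i] lies in the fixed interval from [c] to [16 W^2 / delta^2], away
    from 0, where the quotient is Lipschitz. *)
Definition well_separated (c W : R) : set (config R M) :=
  [set z | `|z| <= W /\ forall i j, j != i -> c <= xi delta z i j].

Lemma separated_distinct c W : 0 < c ->
  well_separated c W `<=` distinct_positions.
Proof.
move=> c0 z [_ zc]; apply: (distinct_positions_xi delta_gt0) => i j ji.
exact: lt_le_trans c0 (zc _ _ ji).
Qed.

Lemma pair_sum_lip c W : 0 < c -> exists2 L : R, 0 <= L &
  forall (g : config R M -> 'I_M -> 'I_M -> R) z z' w w' i,
  (forall w i j, `|g w i j| <= 2 * `|w|) ->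
  (forall z w i j, g (z - w) i j = g z i j - g w i j) ->
  well_separated c W z -> well_separated c W z' ->
  well_separated c W w -> well_separated c W w' ->
  `|pair_sum g z z' i - pair_sum g w w' i| <= L * (`|z - w| + `|z' - w'|).
Proof.
move=> c0; pose X := 16 * W / delta ^+ 2.
have [Lq Lq0 qlip] := @blob_quotient_lip R m c (16 * W ^+ 2 / delta ^+ 2) hm c0.
(* The 4 bounds the quotient and [2 W] the mean of [g] in the splitting of the product difference.
   Absolute values keep the constant nonnegative before a configuration in the region shows
   [W >= 0]. *)
exists (total_omega * (4 + 2 * `|W| * (Lq * `|X|))).
  by rewrite mulr_ge0 ?total_omega_ge0// addr_ge0// !mulr_ge0.
move=> g z z' w w' i gle gB sz sz' sw sw'.
set dd := `|z - w| + `|z' - w'|; have dd0 : 0 <= dd by rewrite addr_ge0.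
have W0 : 0 <= W by apply: le_trans (proj1 sz).
have X0 : 0 <= X by rewrite divr_ge0 ?sqr_ge0// mulr_ge0.
rewrite (ger0_norm W0) (ger0_norm X0).
rewrite /pair_sum -sumrB; under eq_bigr do rewrite -mulrBr.
rewrite -mulrA; apply: omega_sum_le.
  apply: mulr_ge0 => //; apply: addr_ge0 => //.
  by apply: mulr_ge0; exact: mulr_ge0.
move=> j ji.
have rng u : well_separated c W u ->
    c <= xi delta u i j <= 16 * W ^+ 2 / delta ^+ 2.
  by move=> [uW uc]; rewrite uc// xi_le.
have dist_of u : well_separated c W u -> distinct_positions u.
  exact: separated_distinct.
set q := blob_quotient _ _ _; set q' := blob_quotient _ _ _.
set a := (_ + _) / 2; set a' := (_ + _) / 2.
have qq' : `|q - q'| <= Lq * (X * dd).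
  have := qlip _ _ _ _ (rng _ sz) (rng _ sz') (rng _ sw) (rng _ sw').
  move=> /le_trans; apply.
  rewrite ler_wpM2l// mulrDr; apply: lerD.
    by apply: xi_lip; [case: sz|case: sw].
  by apply: xi_lip; [case: sz'|case: sw'].
have q4 : `|q| <= 4.
  by apply: blob_quotient_le => //; apply: xi_gt0 => //; exact: dist_of.
have a'W : `|a'| <= 2 * W.
  rewrite normrM normfV (@ger0_norm _ 2)// ler_pdivrMr//.
  rewrite (le_trans (ler_normD _ _))//.
  have := gle w i j; have := gle w' i j; case: sw sw' => ? _ [? _]; lra.
have aa' : `|a - a'| <= dd.
  rewrite -mulrBl normrM normfV (@ger0_norm _ 2)// ler_pdivrMr//.
  have -> : g z' i j + g z i j - (g w' i j + g w i j) =
    g (z' - w') i j + g (z - w) i j by rewrite !gB; ring.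
  rewrite (le_trans (ler_normD _ _))//.
  by have := gle (z' - w') i j; have := gle (z - w) i j; rewrite /dd; lra.
have -> : a * q - a' * q' = q * (a - a') + a' * (q - q') by ring.
rewrite (le_trans (ler_normD _ _))// (normrM q) (normrM a') mulrDl.
rewrite lerD//; first exact: ler_pM.
by rewrite -(mulrA _ _ dd) -(mulrA _ _ dd); apply: ler_pM.
Qed.

Lemma scheme_field_lip c W : 0 < c -> exists2 L : R, 0 <= L &
  forall z z' w w',
  well_separated c W z -> well_separated c W z' ->
  well_separated c W w -> well_separated c W w' ->
  `|scheme_field z z' - scheme_field w w'| <= L * (`|z - w| + `|z' - w'|).
Proof.
move=> c0; have [L L0 pslip] := pair_sum_lip W c0; have s0 := strength_ge0.
exists (strength * L); first exact: mulr_ge0.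
move=> z z' w w' sz sz' sw sw'; apply: config_norm_le => [|i|i] /=.
- by apply: mulr_ge0; [exact: mulr_ge0|exact: addr_ge0].
- rewrite !mxE -mulrBr normrM normrN (ger0_norm s0) -mulrA ler_wpM2l//.
  by apply: pslip => //; [exact: dy_le|exact: dyB].
- rewrite !mxE -mulrBr normrM (ger0_norm s0) -mulrA ler_wpM2l//.
  by apply: pslip => //; [exact: dx_le|exact: dxB].
Qed.

Lemma separated_tube c W z w : 0 < c -> well_separated c W z -> 0 <= W ->
  `|w - z| <= 1 -> 16 * (W + 1) / delta ^+ 2 * `|w - z| <= c / 2 ->
  well_separated (c / 2) (W + 1) w.
Proof.
move=> c0 [zW zc] W0 wz1 wz; have wW : `|w| <= W + 1.
  by rewrite -(subrK z w) addrC (le_trans (ler_normD _ _))// lerD.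
split=> // i j ji.
have zW1 : `|z| <= W + 1 by rewrite (le_trans zW)// lerDl.
have := le_trans (@xi_lip R M delta (W + 1) w z i j wW zW1) wz.
have := zc i j ji; have := ler_norm (xi delta z i j - xi delta w i j).
by rewrite distrC; lra.
Qed.

End scheme.

(** * Regularity of an exact solution and consistency of the scheme *)

Section trajectory.
Context {R : realType} (m M : nat) (h delta : R) (omega : 'I_M -> R).
Context (T : R) (z : R -> config R M).
Hypothesis hm : m \in [:: 2; 4; 6]%N.
Hypothesis delta_gt0 : 0 < delta.
Hypothesis T_gt0 : 0 < T.
Hypothesis z_sol : blob_solution m h delta omega T z.
Implicit Types (i j : 'I_M) (g : config R M -> 'I_M -> 'I_M -> R).

Let z_cont : {within `[0, T], continuous z}. Proof. by case: z_sol. Qed.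

(** Compactness of [[0, T]]: the norm attains a maximum and each of the finitely many [xi] attains a
    positive minimum. *)
Lemma solution_separated : exists c W : R, [/\ 0 < c, 0 <= W &
  forall t : R, 0 <= t <= T -> well_separated delta c W (z t)].
Proof.
have [s s0T zmax] : exists2 s, s \in `[0, T]%R &
    forall t, t \in `[0, T]%R -> `|z t| <= `|z s|.
  apply: EVT_max; first exact: ltW.
  apply: (continuous_within_le (C := 1) z_cont) => t t' _ _.
  by rewrite mul1r ler_dist_dist.
pose W := `|z s|.
have zW t : 0 <= t <= T -> `|z t| <= W.
  by move=> ht; apply: zmax; rewrite in_itv.
(* The lower bound is written [1 <= K xi] because this form is preserved when [K] grows, as
   [uniform_bound_ord] requires. *)
have sep_ij i j : exists2 K, 0 <= K & j != i ->
    forall t, 0 <= t <= T -> 1 <= K * xi delta (z t) i j.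
  have [->|ji] := eqVneq j i; first by exists 0.
  have [r r0T ximin] : exists2 r, r \in `[0, T]%R &
      forall t, t \in `[0, T]%R -> xi delta (z r) i j <= xi delta (z t) i j.
    apply: EVT_min; first exact: ltW.
    apply: (continuous_within_le z_cont) => t t' ht ht'.
    by apply: xi_lip; exact: zW.
  have xir : 0 < xi delta (z r) i j.
    apply: xi_gt0 => //; case: z_sol => _ + _; apply.
    by move: r0T; rewrite in_itv.
  exists (xi delta (z r) i j)^-1; first by rewrite invr_ge0 ltW.
  move=> _ t ht; rewrite mulrC ler_pdivlMr// mul1r; apply: ximin.
  by rewrite in_itv.
have [K K0 sepK] : exists2 K, 0 <= K & forall i j, j != i ->
    forall t, 0 <= t <= T -> 1 <= K * xi delta (z t) i j.
  have mono i j (K K' : R) : K <= K' ->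
      (j != i -> forall t, 0 <= t <= T -> 1 <= K * xi delta (z t) i j) ->
      j != i -> forall t, 0 <= t <= T -> 1 <= K' * xi delta (z t) i j.
    move=> KK' H ji t ht; apply: le_trans (H ji t ht) _.
    by rewrite ler_wpM2r// sqr_ge0.
  apply: uniform_bound_ord => [i K K' KK' H j|i]; first exact: mono (H j).
  by apply: uniform_bound_ord => [j K K'|j]; [exact: mono|exact: sep_ij].
(* Adding 1 keeps the separation constant positive even if [K = 0]. *)
exists (K + 1)^-1, W; split; [by rewrite invr_gt0 ltr_wpDl|exact: normr_ge0|].
move=> t ht; split=> [|i j ji]; first exact: zW.
rewrite -div1r ler_pdivrMr ?ltr_wpDl// mulrC (le_trans (sepK i j ji t ht))//.
by rewrite ler_wpM2r ?sqr_ge0// lerDl.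
Qed.

Context (c W : R).
Hypothesis c_gt0 : 0 < c.
Hypothesis z_sep : forall t : R, 0 <= t <= T -> well_separated delta c W (z t).

Let d := 16 * W ^+ 2 / delta ^+ 2.

Let xi_itv i j : j != i ->
  forall t : R, 0 <= t <= T -> c <= xi delta (z t) i j <= d.
Proof. by move=> ji t /z_sep[zW zc]; rewrite zc//= xi_le. Qed.

Let velocity_xE (t : R) i : 0 <= t <= T -> velocity_x m h delta omega (z t) i =
  - strength h delta * pair_flow m delta omega dy (z t) i.
Proof.
move=> /z_sep/(separated_distinct delta_gt0 c_gt0) dz.
by rewrite /velocity_x mulNr (velocity_sumE _ _ _ delta_gt0 dy)// mulNr.
Qed.

Let velocity_yE (t : R) i : 0 <= t <= T -> velocity_y m h delta omega (z t) i =
  strength h delta * pair_flow m delta omega dx (z t) i.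
Proof.
move=> /z_sep/(separated_distinct delta_gt0 c_gt0) dz.
exact: velocity_sumE.
Qed.

Let z1' i (t : R) : 0 < t < T -> is_derive t 1 (fun s : R => (z s).1 0 i)
  (- strength h delta * pair_flow m delta omega dy (z t) i).
Proof.
move=> /[dup] /andP[/ltW t0 /ltW tT] ht; rewrite -velocity_xE ?t0//.
by case: z_sol => _ _ /(_ t ht i)[].
Qed.

Let z2' i (t : R) : 0 < t < T -> is_derive t 1 (fun s : R => (z s).2 0 i)
  (strength h delta * pair_flow m delta omega dx (z t) i).
Proof.
move=> /[dup] /andP[/ltW t0 /ltW tT] ht; rewrite -velocity_yE ?t0//.
by case: z_sol => _ _ /(_ t ht i)[].
Qed.

Let z1_cont i : {within `[0, T], continuous (fun s : R => (z s).1 0 i)}.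
Proof.
apply: (continuous_within_le (C := 1) z_cont) => s t _ _; rewrite mul1r.
by have [+ _] := config_coord_le (z s - z t) i; rewrite !mxE.
Qed.

Let z2_cont i : {within `[0, T], continuous (fun s : R => (z s).2 0 i)}.
Proof.
apply: (continuous_within_le (C := 1) z_cont) => s t _ _; rewrite mul1r.
by have [_ +] := config_coord_le (z s - z t) i; rewrite !mxE.
Qed.

(** Start of a regularity bootstrap: bounded velocities make the coordinates Lipschitz, hence the
    velocities are Lipschitz along the solution, hence the coordinates have Lipschitz
    derivatives. *)
Let flow_bounded g (k : R) i : (forall w i j, `|g w i j| <= 2 * `|w|) ->
  forall t : R, 0 <= t <= T -> `|k * pair_flow m delta omega g (z t) i| <=
    `|k| * (total_omega omega * (2 * W * 4)).
Proof.
move=> gle t ht; rewrite normrM ler_wpM2l//.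
have [zW _] := z_sep ht; have W0 := le_trans (normr_ge0 _) zW.
apply: omega_sum_le => [|j ji]; first by rewrite !mulr_ge0.
rewrite normrM; apply: ler_pM => //.
  by apply: le_trans (gle _ _ _) _; rewrite ler_wpM2l.
apply: blob_profile_le => //.
by apply: lt_le_trans c_gt0 _; have /andP[] := xi_itv ji ht.
Qed.

Let z1_lip i : lip_on 0 T (fun s : R => (z s).1 0 i).
Proof.
apply: lip_on_derivable (@z1_cont i) (@z1' i) _ => t.
exact: flow_bounded (@dy_le R M) t.
Qed.

Let z2_lip i : lip_on 0 T (fun s : R => (z s).2 0 i).
Proof.
apply: lip_on_derivable (@z2_cont i) (@z2' i) _ => t.
exact: flow_bounded (@dx_le R M) t.
Qed.

Let dx_lip i j : lip_on 0 T (fun s => dx (z s) i j).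
Proof. by apply: lip_onD => //; exact: lip_onN. Qed.

Let dy_lip i j : lip_on 0 T (fun s => dy (z s) i j).
Proof. by apply: lip_onD => //; exact: lip_onN. Qed.

Let xi_traj i j : (fun s => xi delta (z s) i j) = (fun s =>
  (dx (z s) i j * dx (z s) i j + dy (z s) i j * dy (z s) i j) *
  (delta ^+ 2)^-1).
Proof. by apply/funext => s; rewrite xiE !expr2. Qed.

Let xi_traj_lip i j : lip_on 0 T (fun s => xi delta (z s) i j).
Proof.
rewrite xi_traj; apply: lip_onM; last exact: lip_on_cst.
by apply: lip_onD; exact: lip_onM.
Qed.

Let flow_lip g (k : R) i : (forall i j, lip_on 0 T (fun s => g (z s) i j)) ->
  lip_on 0 T (fun s => k * pair_flow m delta omega g (z s) i).
Proof.
move=> lg; apply: lip_onM; first exact: lip_on_cst.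
apply: lip_on_sum => j ji; apply: lip_onM; first exact: lip_on_cst.
apply: lip_onM => //; exact: blob_profile_lip hm c_gt0 (xi_itv ji) _.
Qed.

Let z1_C1 i : C1lip_on 0 T (fun s : R => (z s).1 0 i).
Proof.
split=> //.
exists (fun s => - strength h delta * pair_flow m delta omega dy (z s) i).
  exact: flow_lip.
exact: z1'.
Qed.

Let z2_C1 i : C1lip_on 0 T (fun s : R => (z s).2 0 i).
Proof.
split=> //.
exists (fun s => strength h delta * pair_flow m delta omega dx (z s) i).
  exact: flow_lip.
exact: z2'.
Qed.

Let dx_C1 i j : C1lip_on 0 T (fun s => dx (z s) i j).
Proof. by apply: C1lip_onD => //; exact: C1lip_onN. Qed.

Let dy_C1 i j : C1lip_on 0 T (fun s => dy (z s) i j).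
Proof. by apply: C1lip_onD => //; exact: C1lip_onN. Qed.

(** End of the bootstrap: the velocity itself has a Lipschitz derivative in time, the regularity
    that [trapezoid] demands. *)
Let flow_C1 g (k : R) i : (forall i j, C1lip_on 0 T (fun s => g (z s) i j)) ->
  C1lip_on 0 T (fun s => k * pair_flow m delta omega g (z s) i).
Proof.
move=> lg; apply: C1lip_onM; first exact: C1lip_on_cst.
apply: C1lip_on_sum => j ji; apply: C1lip_onM; first exact: C1lip_on_cst.
apply: C1lip_onM => //; apply: C1lip_on_blob_profile c_gt0 _ _ => //.
  by move=> t ht; have /andP[] := xi_itv ji ht.
rewrite xi_traj; apply: C1lip_onM; last exact: C1lip_on_cst.
by apply: C1lip_onD; exact: C1lip_onM.
Qed.

(** The trapezoidal mean [fl] of the velocity is the intermediary: the exact increment differs from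
    [tau fl] by [O(tau^3)], and the field of the scheme differs from [fl] by [O(tau^2)], which the
    step size multiplies by [tau]. *)
Let coordinate_consistent g (k : R) i (phi : R -> R) :
  (forall i j, C1lip_on 0 T (fun s => g (z s) i j)) ->
  {within `[0, T], continuous phi} ->
  (forall t : R, 0 < t < T ->
     is_derive t 1 phi (k * pair_flow m delta omega g (z t) i)) ->
  exists2 K : R, 0 <= K & forall t tau : R, 0 <= t -> 0 < tau -> t + tau <= T ->
    `|phi (t + tau) - phi t -
      tau * (k * pair_sum m delta omega g (z t) (z (t + tau)) i)| <=
      K * tau ^+ 3.
Proof.
move=> lg phic phid.
have [K1 K10 trap] := trapezoid phic phid (flow_C1 k i lg).
have [K2 K20 quad] : exists2 K : R, 0 <= K & forall j, j != i ->
  forall s t, 0 <= s <= T -> 0 <= t <= T ->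
    `|(g (z t) i j + g (z s) i j) / 2 *
        blob_quotient m (xi delta (z s) i j) (xi delta (z t) i j) -
      (g (z s) i j * blob_profile m (xi delta (z s) i j) +
       g (z t) i j * blob_profile m (xi delta (z t) i j)) / 2| <=
    K * `|t - s| ^+ 2.
  apply: uniform_bound_ord => [j K K' KK' H ji s t hs ht|j].
    by apply: le_trans (H ji s t hs ht) _; rewrite ler_wpM2r// sqr_ge0.
  have [->|ji] := eqVneq j i; first by exists 0.
  have [K K0 H] := pair_quadrature hm c_gt0 (xi_itv ji) (proj1 (lg i j))
    (xi_traj_lip i j).
  by exists K.
exists (K1 + `|k| * (total_omega omega * K2)).
  by rewrite addr_ge0// mulr_ge0// mulr_ge0// total_omega_ge0.
move=> t tau t0 tau0 tT; set t' := t + tau.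
have ht : 0 <= t <= T by rewrite t0 (le_trans _ tT)// lerDl ltW.
have ht' : 0 <= t' <= T by rewrite /t' tT andbT addr_ge0// ltW.
have tt' : t' - t = tau by rewrite /t' addrC addKr.
have nt : `|tau| = tau by rewrite gtr0_norm.
have := trap _ _ ht ht'; rewrite tt' nt => h1.
set fl := (_ + _) / 2 in h1.
have h2 : `|k * pair_sum m delta omega g (z t) (z t') i - fl| <=
    `|k| * (total_omega omega * (K2 * tau ^+ 2)).
  have -> : k * pair_sum m delta omega g (z t) (z t') i - fl =
    k * (pair_sum m delta omega g (z t) (z t') i -
      (pair_flow m delta omega g (z t) i +
       pair_flow m delta omega g (z t') i) / 2).
    by rewrite /fl; field.
  rewrite normrM ler_wpM2l// /pair_sum /pair_flow -big_split/= mulr_suml -sumrB.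
  rewrite (eq_bigr (fun j => omega j *
    ((g (z t') i j + g (z t) i j) / 2 *
        blob_quotient m (xi delta (z t) i j) (xi delta (z t') i j) -
      (g (z t) i j * blob_profile m (xi delta (z t) i j) +
       g (z t') i j * blob_profile m (xi delta (z t') i j)) / 2))); last first.
    by move=> j _; field.
  apply: omega_sum_le => [|j ji]; first by rewrite mulr_ge0// sqr_ge0.
  by have := quad j ji t t' ht ht'; rewrite tt' nt.
have -> : phi t' - phi t - tau * (k * pair_sum m delta omega g (z t) (z t') i) =
  (phi t' - phi t - tau * fl) -
    tau * (k * pair_sum m delta omega g (z t) (z t') i - fl) by ring.
rewrite (le_trans (ler_normB _ _))// [leRHS]mulrDl; apply: lerD => //.
rewrite normrM nt (_ : _ * tau ^+ 3 =
  tau * (`|k| * (total_omega omega * (K2 * tau ^+ 2)))); last by ring.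
by rewrite ler_pM2l.
Qed.

Lemma scheme_consistent : exists2 K : R, 0 <= K &
  forall t tau : R, 0 <= t -> 0 < tau -> t + tau <= T ->
    `|z (t + tau) - z t -
      tau *: scheme_field m h delta omega (z t) (z (t + tau))| <= K * tau ^+ 3.
Proof.
pose ok (phi : R -> R) (ps : R -> R -> R) (K : R) :=
  forall t tau : R, 0 <= t -> 0 < tau -> t + tau <= T ->
    `|phi (t + tau) - phi t - tau * ps t (t + tau)| <= K * tau ^+ 3.
have ok_mono phi ps K K' : K <= K' -> ok phi ps K -> ok phi ps K'.
  move=> KK' H t tau t0 tau0 tT; apply: le_trans (H t tau t0 tau0 tT) _.
  by rewrite ler_wpM2r// exprn_ge0// ltW.
have [K1 K10 H1] : exists2 K, 0 <= K & forall i, ok (fun s : R => (z s).1 0 i)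
    (fun s t => - strength h delta * pair_sum m delta omega dy (z s) (z t) i) K.
  apply: uniform_bound_ord => [i K K'|i]; first exact: ok_mono.
  by apply: coordinate_consistent => //; exact: z1'.
have [K2 K20 H2] : exists2 K, 0 <= K & forall i, ok (fun s : R => (z s).2 0 i)
    (fun s t => strength h delta * pair_sum m delta omega dx (z s) (z t) i) K.
  apply: uniform_bound_ord => [i K K'|i]; first exact: ok_mono.
  by apply: coordinate_consistent => //; exact: z2'.
exists (K1 + K2) => [|t tau t0 tau0 tT]; first exact: addr_ge0.
have tau3 : 0 <= tau ^+ 3 by rewrite exprn_ge0// ltW.
apply: config_norm_le => [|i|i].
- by rewrite mulr_ge0// addr_ge0.
- apply: le_trans (_ : K1 * tau ^+ 3 <= _); last by rewrite ler_wpM2r// lerDl.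
  by have := H1 i t tau t0 tau0 tT; rewrite /= !mxE.
- apply: le_trans (_ : K2 * tau ^+ 3 <= _); last by rewrite ler_wpM2r// lerDr.
  by have := H2 i t tau t0 tau0 tT; rewrite /= !mxE.
Qed.

End trajectory.

Theorem mainTheorem2 (R : realType) (m M : nat) (h delta : R)
    (omega : 'I_M -> R)
    (hm : m \in [:: 2; 4; 6]%N) (h_gt0 : 0 < h) (delta_gt0 : 0 < delta) :
  symmetric_method (blob_scheme m h delta omega) /\
  accurate_of_order 2 (blob_scheme m h delta omega)
    (blob_solution m h delta omega).
Proof.
split; first exact: blob_scheme_symmetric.
move=> T z T_gt0 z_sol.
have [c [W [c0 W0 zsep]]] := solution_separated delta_gt0 T_gt0 z_sol.
have [K K0 cons] := scheme_consistent hm delta_gt0 z_sol c0 zsep.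
have c20 : 0 < c / 2 by rewrite divr_gt0.
have [L L0 lip] := scheme_field_lip h omega hm delta_gt0 (W + 1) c20.
pose X := 16 * (W + 1) / delta ^+ 2.
have X0 : 0 <= X by rewrite divr_ge0 ?sqr_ge0// mulr_ge0// addr_ge0.
(* Radius 1 keeps norms below [W + 1]; the other bound lets each [xi] drop by at most [c / 2]. The
   denominator [X + 1] is positive even when [X = 0]. *)
pose rho := Num.min 1 (c / 2 / (X + 1)).
have X1 : 0 < X + 1 by rewrite ltr_wpDl.
have rho0 : 0 < rho by rewrite lt_min ltr01 divr_gt0.
(* The added 1 makes [B] positive even if all [omega j] vanish. *)
pose B := strength h delta * total_omega omega * 4 + 1.
have B0 : 0 < B.
  by rewrite ltr_wpDl// mulr_ge0// mulr_ge0 ?strength_ge0 ?total_omega_ge0.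
apply: (@implicit_one_step_convergence R _ (blob_scheme m h delta omega)
  (scheme_field m h delta omega) distinct_positions
  (well_separated delta (c / 2) (W + 1))
  z T rho W B (L + 1) K) => //.
- by rewrite ltr_wpDl.
- exact: separated_distinct.
- by move=> tau v v' tau0; apply: blob_schemeE => //; rewrite gt_eqF.
- move=> t v ht; rewrite le_min => /andP[v1 vX].
  apply: separated_tube (zsep _ ht) _ _ _ => //.
  move: vX; rewrite ler_pdivlMr// => vX; apply: le_trans vX.
  by rewrite mulrC ler_wpM2l// lerDl.
- by move=> t /zsep[].
- move=> v v' sv sv'.
  apply: le_trans (scheme_field_le h omega hm delta_gt0 sv sv') _.
  by rewrite ler_wpM2r ?addr_ge0// lerDl.
- move=> v v' w w' sv sv' sw sw'; apply: le_trans (lip _ _ _ _ sv sv' sw sw') _.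
  by rewrite ler_wpM2r ?addr_ge0// lerDl.
Qed.
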